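(* Let $n\ge1$ and let $X\sim\mathcal N(0,I_{n\times n})$ be the standard Gaussian vector in $\mathbb R^n$. Let $F:[0,\infty)\to[0,\infty)$ be the function $F(x)=\int_0^x e^{k((k')^{-1}(t))}\,dt$ defined in the context. Then for every $f\in C_0^\infty(\mathbb R^n)$, $$\log\mathbb E\, e^{f(X)-\mathbb E f(X)}\le \mathbb E\, F(|\nabla f(X)|).$$
   Context: $C_0^\infty(\mathbb R^n)$ denotes the real-valued infinitely differentiable compactly supported functions on $\mathbb R^n$; $|\cdot|$ is the Euclidean norm. For $x\in\mathbb R$ put $$k(x)=\frac{x^2}{2}+\log\left(\int_{-\infty}^x e^{-s^2/2}\,ds\right)$$ (equivalently $k=-\log(\Phi'/\Phi)$, with $\Phi$ the standard Gaussian cumulative distribution function). The derivative $k'$ is strictly increasing with $k'(x)\to0$ as $x\to-\infty$ and $k'(x)\to\infty$ as $x\to\infty$, so it has an inverse $(k')^{-1}:(0,\infty)\to\mathbb R$. The function $F$ is $F(x)=\int_0^x e^{k((k')^{-1}(t))}\,dt$ for $x\ge 0$. *)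

(* Defs.v *)
From HB Require Import structures.
From mathcomp Require Import all_boot all_order all_algebra.
From mathcomp Require Import all_classical all_reals all_analysis.
Set Implicit Arguments.
Unset Strict Implicit.
Unset Printing Implicit Defensive.
Import Order.TTheory GRing.Theory Num.Theory.
Import numFieldNormedType.Exports.
Local Open Scope classical_set_scope.
Local Open Scope ring_scope.

Section smooth_functions.
Context {R : realType} {n : nat}.
Implicit Types (f : 'rV[R]_n -> R) (v x : 'rV[R]_n).

(* The library norm `|v| on 'rV[R]_n is the sup norm; it induces the usual
   topology and differentiability, but it is not the norm of the gradient. *)
Definition enorm v : R := Num.sqrt (\sum_(i < n) v ord0 i ^+ 2).

Definition partial (i : 'I_n) f x : R := 'D_(delta_mx ord0 i) f x.

Definition gradient f x : 'rV[R]_n := \row_(i < n) partial i f x.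

Fixpoint Ck (m : nat) f : Prop :=
  if m is m'.+1
  then (forall x, differentiable f x) /\ forall i, Ck m' (partial i f)
  else continuous f.

Definition smooth f : Prop := forall m, Ck m f.

Definition compactly_supported f : Prop := compact (closure [set x | f x != 0]).

Definition test_function f : Prop := smooth f /\ compactly_supported f.

End smooth_functions.

Section gaussian_vector.
Context {d : measure_display} {T : measurableType d} {R : realType}.
Implicit Types P : probability T R.

(* Events of the form Y_i \in B_i, i \in J, for every finite J. *)
Definition mutually_independent P {n : nat} (Y : 'I_n -> T -> R) : Prop :=
  forall (J : {set 'I_n}) (B : 'I_n -> set R),
    (forall i, measurable (B i)) ->
    P [set w | forall i, i \in J -> B i (Y i w)] =
    (\prod_(i in J) P (Y i @^-1` B i))%E.

(* X ~ N(0, I_n): the coordinates of X are independent and each has law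
   N(0, 1). *)
Record standard_gaussian_vector P {n : nat} (X : T -> 'rV[R]_n) : Prop :=
  StandardGaussianVector {
    sgv_measurable : forall i, measurable_fun setT (fun w => X w ord0 i) ;
    sgv_marginal : forall i (B : set R), measurable B ->
      P ((fun w => X w ord0 i) @^-1` B) = normal_prob 0 1 B ;
    sgv_independent : mutually_independent P (fun i w => X w ord0 i) }.

End gaussian_vector.

Section k_and_F.
Context {R : realType}.
Implicit Types x t : R.

Definition kfun x : R :=
  x ^+ 2 / 2 +
  ln (\int[lebesgue_measure]_(s in `]-oo, x]) expR (- (s ^+ 2 / 2)))%R.

(* (k')^-1; its value is irrelevant (here 0) outside the range ]0, +oo[ of
   k'. *)
Definition kprime_inv : R -> R := 'pinv_(fun=> 0) [set: R] kfun^`()%classic.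

(* The endpoint 0, a null set, is left out since (k')^-1 is not defined
   there. *)
Definition Ffun x : R :=
  (\int[lebesgue_measure]_(t in `]0%R, x]) expR (kfun (kprime_inv t)))%R.

End k_and_F.

(* Main.v *)
Require Import Defs.
From HB Require Import structures.
From mathcomp Require Import all_boot all_order all_algebra.
From mathcomp Require Import all_classical all_reals all_analysis.
From mathcomp Require Import measurable_realfun ring lra.

(* Put K = exp k, so that K' = s K + 1 and k' = K' / K, and let
M(a, y) = ln a + F(y / a).  With a = c K(s) and y = c K'(s) the partial
derivatives of M are M_a = - s / c and M_y = 1 / c, and M lies above its
tangent planes up to a degenerate second order term (Mfun_support).  This
gives, for one-dimensional Gaussian averages,
   M(E u, E b) <= E M(u, sqrt(b^2 + u'^2)) :
the Gaussian variable is a sum of N independent small ones, and each step loses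
only O(N^(-3/2)).  In dimension n one averages over the coordinates in turn:
with y = sqrt(ep + |grad u|^2), the partial derivatives that remain after an
average are kept in b, and Minkowski's inequality lets the average act on each
of them.  For u = e^f the outcome is
   ln E e^f <= M(E e^f, sqrt ep) <= E M(e^f, sqrt(ep + |grad e^f|^2)),
whose right-hand side tends to E f + E F(|grad f|) as ep tends to 0. *)

Set Implicit Arguments.
Unset Strict Implicit.
Unset Printing Implicit Defensive.
Import Order.TTheory GRing.Theory Num.Theory.
Import numFieldNormedType.Exports.
Local Open Scope classical_set_scope.
Local Open Scope ring_scope.

(** The support inequality takes the place of an infinitesimal argument along the heat flow: no
    second derivative of M has to exist and nothing is differentiated under an integral. Derivatives
    of u enter only through quadratic Taylor bounds and Lipschitz constants, which averaging
    preserves without loss, so one constant C serves all N steps of size d = N^(-1/2), and N C d^3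
    tends to 0. In one step, with q = (d u')^2, the square root gains q / (2 b0), while the term (a
    - a0)^2 / (2 b0) costs q z^2 / (2 b0) to leading order; since E z^2 <= 1 the balance is
    nonnegative in mean. Between steps the induction carries sqrt(b^2 + tau u'^2), where tau is the
    variance not yet averaged. The number ep keeps y away from 0, where the division by 2 b0 would
    lose all uniformity; together with two-sided bounds on u it confines the parameters to a compact
    set. The vector X lives on an arbitrary probability space. To average over coordinate i, that
    space itself, with the sigma-algebra generated by the other coordinates, serves as the first
    factor of a product. *)

Section calculus.
Context {R : realType}.
Implicit Types (f df : R -> R) (a b x : R).

Lemma is_derive1_continuous f x (d : R) :
  is_derive x 1 f d -> {for x, continuous f}.
Proof.
by move=> fx; apply: differentiable_continuous; apply/derivable1_diffP; exact: ex_derive.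
Qed.

Lemma derive_mean_value f df a b : a <= b ->
  (forall x, is_derive x 1 f (df x)) ->
  exists2 c, a <= c <= b & f b - f a = df c * (b - a).
Proof.
move=> ab fdf; have [|c cab e] := @MVT_segment R f df a b ab (fun x _ => fdf x).
  by apply: continuous_subspaceT => x; exact: is_derive1_continuous (fdf x).
by exists c => //; move: cab; rewrite in_itv.
Qed.

Lemma le_derive_ndecr f df a b : a <= b ->
  (forall x, is_derive x 1 f (df x)) ->
  (forall x, a <= x <= b -> 0 <= df x) -> f a <= f b.
Proof.
move=> ab fdf df0; have [c /df0 c0 e] := derive_mean_value ab fdf.
by rewrite -subr_ge0 e mulr_ge0// subr_ge0.
Qed.

Lemma lt_derive_incr f df a b : a < b ->
  (forall x, is_derive x 1 f (df x)) ->
  (forall x, a <= x <= b -> 0 < df x) -> f a < f b.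
Proof.
move=> ab fdf df0; have [c /df0 c0 e] := derive_mean_value (ltW ab) fdf.
by rewrite -subr_gt0 e mulr_gt0// subr_gt0.
Qed.

(** Since f increases, a negative value would keep f below a negative number on the whole half-line
    to its left. The third hypothesis, a substitute for a limit at -oo, excludes this by points
    arbitrarily far left where f exceeds - e. *)
Lemma derive_gt0_gt0 f df :
  (forall x, is_derive x 1 f (df x)) -> (forall x, 0 < df x) ->
  (forall x e, 0 < e -> exists2 y, y < x & - e < f y) -> forall x, 0 < f x.
Proof.
move=> fdf df0 fNy.
have f0 x : 0 <= f x.
  rewrite leNgt; apply/negP => fx.
  have [|y yx] := fNy x (- f x); first by rewrite oppr_gt0.
  by rewrite opprK; apply/negP; rewrite -leNgt ltW// (lt_derive_incr yx fdf).
move=> x; apply: le_lt_trans (f0 (x - 1)) _.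
by apply: (lt_derive_incr _ fdf) => //; rewrite ltrBlDr ltrDl.
Qed.

Lemma is_derive1M f g x (df dg : R) : is_derive x 1 f df -> is_derive x 1 g dg ->
  is_derive x 1 (fun t => f t * g t) (df * g x + f x * dg).
Proof.
move=> fd gd; apply: (is_derive_eq (is_deriveM fd gd)).
by rewrite addrC mulrC.
Qed.

Lemma is_derive1D f g x (df dg : R) : is_derive x 1 f df -> is_derive x 1 g dg ->
  is_derive x 1 (fun t => f t + g t) (df + dg).
Proof. by move=> fd gd; exact: is_deriveD. Qed.

Lemma is_derive1B f g x (df dg : R) : is_derive x 1 f df -> is_derive x 1 g dg ->
  is_derive x 1 (fun t => f t - g t) (df - dg).
Proof. by move=> fd gd; exact: is_deriveB. Qed.

Lemma is_derive1_id x : is_derive x 1 (fun t : R => t) 1.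
Proof. exact: is_derive_id. Qed.

Lemma is_derive1_expR_comp f x (df : R) : is_derive x 1 f df ->
  is_derive x 1 (fun t => expR (f t)) (expR (f x) * df).
Proof. by move=> fd; exact: (is_derive1_comp (is_derive_expR (f x)) fd). Qed.

Lemma is_derive1_ln_comp f x (df : R) : 0 < f x -> is_derive x 1 f df ->
  is_derive x 1 (fun t => ln (f t)) (df / f x).
Proof.
move=> f0 fd; apply: (is_derive_eq (is_derive1_comp (is_derive1_ln f0) fd)).
by rewrite mulrC.
Qed.

Lemma is_derive1V_comp f x (df : R) : f x != 0 -> is_derive x 1 f df ->
  is_derive x 1 (fun t => (f t)^-1) (- (df / f x ^+ 2)).
Proof.
move=> f0 fd; apply: (is_derive_eq (is_deriveV f0 fd)).
by rewrite /GRing.scale/= mulNr mulrC.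
Qed.

End calculus.

(** * The Gaussian tail integral and its decay at -oo *)

Section gaussian_tail.
Context {R : realType}.
Implicit Types x s : R.
Local Notation mu := (@lebesgue_measure R).

Definition gauss_dens s : R := expR (- (s ^+ 2 / 2)).

Definition gtail x : R := \int[mu]_(s in `]-oo, x]) gauss_dens s.

(** The Mills ratio of the standard Gaussian at - x. *)
Definition Kfun x : R := expR (x ^+ 2 / 2) * gtail x.

Lemma integrable_normal_fun (m : R) :
  mu.-integrable setT (EFin \o normal_fun m 1).
Proof.
have := @integrable_normal_pdf R m 1.
rewrite normal_pdfE ?oner_neq0// => /integrableZl => /(_ measurableT (normal_peak 1)^-1).
apply: eq_integrable => //= x _.
by rewrite -EFinM mulrA mulVf ?mul1r// gt_eqF// normal_peak_gt0 ?oner_neq0.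
Qed.

Lemma gauss_densE : gauss_dens = normal_fun 0 1.
Proof. by apply/funext => x; rewrite /normal_fun subr0 expr1n mulNr. Qed.

Lemma integrable_gauss_dens : mu.-integrable setT (EFin \o gauss_dens).
Proof. by rewrite gauss_densE; exact: integrable_normal_fun. Qed.

Lemma is_derive_half_sqr x : is_derive x 1 (fun t => t ^+ 2 / 2) x.
Proof.
apply: (@is_derive_eq _ _ _ _ _ _ _ ((1 * x + x * 1) * 2^-1 + x ^+ 2 * 0)).
  apply: is_derive1M; first exact: (is_derive1M (is_derive1_id x) (is_derive1_id x)).
by rewrite mul1r mulr1 mulr0 addr0 -mulr2n -[_ *+ 2]mulr_natr mulfK.
Qed.

Lemma is_derive_gauss_dens x : is_derive x 1 gauss_dens (- x * gauss_dens x).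
Proof.
rewrite mulrC; apply: is_derive1_expR_comp.
exact: (is_deriveN (is_derive_half_sqr x)).
Qed.

Lemma is_derive_gtail x : is_derive x 1 gtail (gauss_dens x).
Proof.
have xx1 : x < x + 1 by rewrite ltrDl.
have [||//|d e] := @continuous_FTC1 R gauss_dens -oo%O x _ xx1.
- exact: integrableS integrable_gauss_dens.
- exact: ltNyr.
- exact: is_derive1_continuous (is_derive_gauss_dens x).
- by apply: DeriveDef; [exact: d|rewrite -derive1E; exact: e].
Qed.

Lemma gauss_dens_gt0 x : 0 < gauss_dens x. Proof. exact: expR_gt0. Qed.

Lemma gtail_ge0 x : 0 <= gtail x.
Proof. by apply: Rintegral_ge0 => s _; exact/ltW/gauss_dens_gt0. Qed.

Lemma gtail_gt0 x : 0 < gtail x.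
Proof.
apply: le_lt_trans (gtail_ge0 (x - 1)) _.
apply: (lt_derive_incr _ is_derive_gtail) => [|y _]; last exact: gauss_dens_gt0.
by rewrite ltrBlDr ltrDl.
Qed.

(** For s <= x one has 1 <= e^(x - s), and e^(-s) e^(-s^2/2) is e^(1/2) times a Gaussian bump
    centred at -1, hence integrable. The summand 1 in the constant makes it positive. *)
Lemma gtail_le_expR : exists2 C : R, 0 < C & forall x, gtail x <= C * expR x.
Proof.
pose g s : R := expR (2^-1) * normal_fun (-1) 1 s.
have gE s : g s = expR (- s) * gauss_dens s.
  rewrite /g /gauss_dens /normal_fun -!expRD; congr expR.
  by rewrite opprK expr1n; field.
have ig : mu.-integrable setT (EFin \o g).
  have := integrableZl measurableT (expR 2^-1) (integrable_normal_fun (-1)).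
  by apply: eq_integrable.
have g0 s : 0 <= g s by rewrite gE mulr_ge0// ?expR_ge0.
have ig0 : 0 <= \int[mu]_s g s by apply: Rintegral_ge0 => s _; exact: g0.
exists (1 + \int[mu]_s g s); first by rewrite ltr_pwDl.
move=> x; apply: (@le_trans _ _ (\int[mu]_s g s * expR x)); last first.
  by rewrite ler_pM2r ?expR_gt0// lerDr.
rewrite -RintegralZr//.
have igx : mu.-integrable setT (EFin \o (fun s => g s * expR x)).
  have := @integrableZr _ _ _ mu setT measurableT (expR x) _ ig.
  by apply: eq_integrable => //= s _.
apply: (@le_trans _ _ (\int[mu]_(s in `]-oo, x]) (g s * expR x))).
  apply: le_Rintegral => //.
  - exact: integrableS integrable_gauss_dens.
  - exact: integrableS igx.
  - move=> s /=; rewrite in_itv/= => sx; rewrite gE mulrAC -expRD.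
    rewrite -[leLHS]mul1r ler_pM2r ?gauss_dens_gt0//.
    by rewrite -expR0 ler_expR addrC subr_ge0.
rewrite Rintegral_mkcond; apply: le_Rintegral => //.
- rewrite -restrict_EFin; apply/integrable_restrict => //=.
  by rewrite setTI; exact: integrableS igx.
- move=> s _ /=; rewrite patchE; case: ifP => // _.
  by rewrite mulr_ge0 ?expR_ge0.
Qed.

End gaussian_tail.

(** * Positivity, monotonicity and range of K and k' *)

Section Kfun_analysis.
Context {R : realType}.
Implicit Types x s : R.

Lemma Kfun_gt0 x : 0 < Kfun x.
Proof. by rewrite mulr_gt0 ?expR_gt0// gtail_gt0. Qed.

Lemma expR_gauss_dens x : expR (x ^+ 2 / 2) * gauss_dens x = 1.
Proof. by rewrite -expRD subrr expR0. Qed.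

Definition Kfun1 x : R := x * Kfun x + 1.

Lemma is_derive_Kfun x : is_derive x 1 Kfun (Kfun1 x).
Proof.
have := is_derive1M (is_derive1_expR_comp (is_derive_half_sqr x)) (is_derive_gtail x).
by move=> /is_derive_eq; apply; rewrite expR_gauss_dens /Kfun1 /Kfun mulrAC mulrC.
Qed.

Lemma mul_gtail_small x (e : R) : 0 < e ->
  exists2 y, y < x & (y < 0) && (- e < y * gtail y) && (gauss_dens y < e).
Proof.
move=> e0; have [C C0 gC] := @gtail_le_expR R.
(* Each summand meets one requirement: |x| puts - t below x, 2 C / e makes 2 C / t < e, which bounds
   t times the tail, 2 / e makes the density small, and 2 gives t <= t^2 / 2. *)
pose t : R := `|x| + 2 * C / e + 2 / e + 2.
have t2 : 2 <= t by rewrite lerDr !addr_ge0// ?divr_ge0// ?mulr_ge0// ltW.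
have t0 : 0 < t by exact: lt_le_trans t2.
have tx : - t < x.
  rewrite ltrNl (le_lt_trans (ler_norm _))// normrN /t -!addrA ltrDl.
  by rewrite !addr_gt0// ?divr_gt0// ?mulr_gt0.
have te : t ^+ 2 / 2 <= expR t.
  have := @expR_ge1Dxn _ t 1 (ltW t0).
  by rewrite (_ : 2`! = 2)%N//; lra.
have tC : 2 * C / e < t.
  rewrite /t; have : 0 <= `|x| by []. have : 0 < 2 / e by rewrite divr_gt0.
  by lra.
have t2e : 2 / e < t.
  rewrite /t; have : 0 <= `|x| by []. have : 0 < 2 * C / e by rewrite divr_gt0// mulr_gt0.
  by lra.
exists (- t) => //; rewrite oppr_lt0 t0/=; apply/andP; split.
  rewrite mulNr ltrN2; apply: le_lt_trans (_ : t * (C * (2 / t ^+ 2)) < e).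
    rewrite ler_pM2l//; apply: le_trans (gC _) _; rewrite ler_pM2l// expRN.
    by rewrite -[leRHS]invrK lef_pV2 ?posrE ?expR_gt0 ?invr_gt0 ?divr_gt0 ?exprn_gt0// invf_div.
  rewrite (_ : t * _ = 2 * C / t); last by field; rewrite gt_eqF.
  by move: tC; rewrite !ltr_pdivrMr// (mulrC t).
rewrite /gauss_dens sqrrN expRN.
have te' : t < expR (t ^+ 2 / 2).
  apply: lt_le_trans (expR_ge1Dx _).
  have : 0 <= t * (t - 2) by rewrite mulr_ge0 ?subr_ge0// ltW.
  by rewrite expr2; lra.
rewrite -[ltRHS]invrK ltf_pV2 ?posrE ?expR_gt0 ?invr_gt0//.
apply: lt_trans te'; apply: le_lt_trans t2e.
by rewrite ler_pMl ?invr_gt0// ler1n.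
Qed.

(** The factor e^(-x^2/2) turns K' into A, whose derivative is the tail integral and which is not
    eventually negative at -oo. *)
Lemma Kfun1_gt0 x : 0 < Kfun1 x.
Proof.
pose A y : R := gauss_dens y + y * gtail y.
have -> : Kfun1 x = expR (x ^+ 2 / 2) * A x.
  by rewrite /A mulrDr expR_gauss_dens /Kfun1 /Kfun mulrCA addrC.
rewrite mulr_gt0 ?expR_gt0//.
apply: (@derive_gt0_gt0 _ A gtail) => [y|y|y e e0]; last 2 first.
- exact: gtail_gt0.
- have [z zy /andP[/andP[_ ze] _]] := mul_gtail_small y e0.
  by exists z => //; rewrite (lt_trans ze)// ltrDr gauss_dens_gt0.
have := is_derive1D (is_derive_gauss_dens y) (is_derive1M (is_derive1_id y) (is_derive_gtail y)).
by move=> /is_derive_eq; apply; ring.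
Qed.

(** This is strict convexity of k, because k' = x + 1 / K has derivative 1 - K' / K^2. The factor
    e^(-x^2/2) turns K^2 - K' into B, and K times the density being the tail reduces B' to the tail
    times K'. *)
Lemma Kfun1_lt_sqr x : Kfun1 x < Kfun x ^+ 2.
Proof.
pose A y : R := gauss_dens y + y * gtail y.
have AE y : Kfun1 y = expR (y ^+ 2 / 2) * A y.
  by rewrite /A mulrDr expR_gauss_dens /Kfun1 /Kfun mulrCA addrC.
pose B y : R := Kfun y * gtail y - A y.
have -> : Kfun x ^+ 2 = Kfun1 x + expR (x ^+ 2 / 2) * B x.
  rewrite AE -mulrDr /B addrC subrK expr2 {1}/Kfun; ring.
rewrite ltrDl mulr_gt0 ?expR_gt0//.
apply: (@derive_gt0_gt0 _ B (fun y => gtail y * Kfun1 y)) => [y|y|y e e0]; last 2 first.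
- by rewrite mulr_gt0 ?gtail_gt0 ?Kfun1_gt0.
- have [z zy /andP[/andP[z0 _] ze]] := mul_gtail_small y e0.
  exists z => //; rewrite /B /A; have := gauss_dens_gt0 z.
  have : 0 < Kfun z * gtail z by rewrite mulr_gt0 ?gtail_gt0 ?Kfun_gt0.
  have : z * gtail z < 0 by rewrite nmulr_rlt0// gtail_gt0.
  by lra.
have := is_derive1B (is_derive1M (is_derive_Kfun y) (is_derive_gtail y))
  (is_derive1D (is_derive_gauss_dens y) (is_derive1M (is_derive1_id y) (is_derive_gtail y))).
move=> /is_derive_eq; apply.
rewrite -[Kfun y * gauss_dens y]mul1r.
have : Kfun y * gauss_dens y = gtail y.
  by rewrite /Kfun mulrAC expR_gauss_dens mul1r.
by move=> ->; ring.
Qed.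

Definition kprime x : R := x + (Kfun x)^-1.

Lemma kprimeE x : kprime x = Kfun1 x / Kfun x.
Proof. by rewrite /kprime /Kfun1 mulrDl mulfK ?gt_eqF ?Kfun_gt0// mul1r. Qed.

Lemma kprime_gt0 x : 0 < kprime x.
Proof. by rewrite kprimeE divr_gt0 ?Kfun1_gt0 ?Kfun_gt0. Qed.

Lemma kprime_lt_Kfun x : kprime x < Kfun x.
Proof. by rewrite kprimeE ltr_pdivrMr ?Kfun_gt0// -expr2 Kfun1_lt_sqr. Qed.

Lemma lt_kprime x : x < kprime x.
Proof. by rewrite ltrDl invr_gt0 Kfun_gt0. Qed.

Lemma kfunE x : kfun x = ln (Kfun x).
Proof. by rewrite /Kfun lnM ?posrE ?expR_gt0 ?gtail_gt0// expRK. Qed.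

Lemma is_derive_kprime x : is_derive x 1 kprime (1 - Kfun1 x / Kfun x ^+ 2).
Proof.
have K0 : Kfun x != 0 by rewrite gt_eqF ?Kfun_gt0.
exact: is_derive1D (is_derive1_id x) (is_derive1V_comp K0 (is_derive_Kfun x)).
Qed.

Lemma is_derive_kfun x : is_derive x 1 kfun (kprime x).
Proof.
rewrite (_ : kfun = (fun y => ln (Kfun y))); last by apply/funext => y; exact: kfunE.
by rewrite kprimeE; exact: is_derive1_ln_comp (Kfun_gt0 x) (is_derive_Kfun x).
Qed.

Lemma kfun_derive1E : kfun^`()%classic = kprime :> (R -> R).
Proof.
by apply/funext => x; rewrite derive1E; have [_ ->] := is_derive_kfun x.
Qed.

Lemma kprime_incr : {homo kprime : x y / x < y}.
Proof.
move=> x y xy; apply: (lt_derive_incr xy is_derive_kprime) => z _.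
by rewrite subr_gt0 ltr_pdivrMr ?mul1r ?Kfun1_lt_sqr// exprn_gt0 ?Kfun_gt0.
Qed.

Lemma Kfun_incr : {homo @Kfun R : x y / x < y}.
Proof.
by move=> x y xy; apply: (lt_derive_incr xy is_derive_Kfun) => z _; exact: Kfun1_gt0.
Qed.

Lemma ler_kprime : {mono kprime : x y / x <= y}.
Proof. exact: le_mono kprime_incr. Qed.

Lemma ler_Kfun : {mono @Kfun R : x y / x <= y}.
Proof. exact: le_mono Kfun_incr. Qed.

Lemma Kfun_lt_inv x : x < 0 -> Kfun x < - x^-1.
Proof.
move=> x0; have := Kfun1_gt0 x; rewrite /Kfun1 => h.
by rewrite -invrN -[ltRHS]mul1r ltr_pdivlMr ?oppr_gt0//; lra.
Qed.

(** The bounds give f (- 1 / t) < t < f t, whence an intermediate value. Both K and k' satisfy them: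
    K < - 1 / x for x < 0 is K' > 0 rewritten, and x < k' < K. *)
Lemma onto_positive (f df : R -> R) : (forall x, is_derive x 1 f (df x)) ->
  (forall x, x < 0 -> f x < - x^-1) -> (forall x, x < f x) ->
  forall t : R, 0 < t -> exists x, f x = t.
Proof.
move=> fdf fNy fy t t0.
have ab : - t^-1 <= t by rewrite (@le_trans _ _ 0)// ?oppr_le0 ?invr_ge0 ltW.
have h1 : f (- t^-1) < t.
  by rewrite (lt_le_trans (fNy _ _)) ?oppr_lt0 ?invr_gt0// invrN invrK opprK.
have h2 := fy t.
have [||x _ <-] := @IVT R f (- t^-1) t t ab; last by exists x.
- by apply: continuous_subspaceT => x; exact: is_derive1_continuous (fdf x).
- by rewrite ge_min le_max (ltW h1) (ltW h2) orbT.
Qed.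

Lemma Kfun_onto (t : R) : 0 < t -> exists x, Kfun x = t.
Proof.
apply: (onto_positive is_derive_Kfun) => x; first exact: Kfun_lt_inv.
exact: lt_trans (lt_kprime x) (kprime_lt_Kfun x).
Qed.

Lemma kprime_onto (t : R) : 0 < t -> exists x, kprime x = t.
Proof.
apply: (onto_positive is_derive_kprime) => x; last exact: lt_kprime.
by move=> /Kfun_lt_inv; exact: lt_trans (kprime_lt_Kfun x).
Qed.

Lemma kprime_invK x : kprime_inv (kprime x) = x.
Proof.
rewrite /kprime_inv kfun_derive1E; apply: pinvKV; last by rewrite inE.
by move=> y z _ _; exact: inc_inj ler_kprime _ _.
Qed.

End Kfun_analysis.

Local Opaque Kfun kprime.

(** * Supporting lines of the primitive of a nondecreasing function *)

Section primitive_of_nondecreasing.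
Context {R : realType}.
Local Notation mu := (@lebesgue_measure R).

Lemma integrable_cst_itv (a b r : R) : mu.-integrable `]a, b] (EFin \o cst r).
Proof.
apply: measurable_bounded_integrable => //.
- by rewrite /= lebesgue_measure_itv/=; case: ifP => // _; exact: ltry.
- exists `|r|; split; first exact: num_real.
  by move=> y yb t _ /=; exact: ltW.
Qed.

Lemma Rintegral_cst_itv (a b r : R) : a <= b ->
  \int[mu]_(t in `]a, b]) r = r * (b - a).
Proof.
move=> ab; rewrite Rintegral_cst//= lebesgue_measure_itv/= lte_fin.
move: ab; rewrite le_eqVlt => /predU1P[->|ab]; last by rewrite ab -EFinD.
by rewrite ltxx subrr.
Qed.

Variable f : R -> R.
Hypothesis f_nd : forall t1 t2, 0 < t1 -> t1 <= t2 -> f t1 <= f t2.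
Hypothesis f_ge0 : forall t, 0 <= f t.

Lemma measurable_pos_ndecr (a b : R) : 0 <= a -> measurable_fun `]a, b] f.
Proof.
(* Monotonicity of f is known only for t > 0; with the value 0 elsewhere it becomes nondecreasing on
   the line because f >= 0. *)
move=> a0; pose g t : R := if 0 < t then f t else 0.
apply: (@eq_measurable_fun _ _ _ _ _ g).
  move=> t; rewrite inE/= in_itv/= => /andP[at_ _].
  by rewrite /g (le_lt_trans a0 at_).
suff g_nd : {homo g : t1 t2 / t1 <= t2}.
  exact: (nondecreasing_measurable (measurable_itv _) g_nd).
move=> t1 t2 t12; rewrite /g; case: ifPn => t10; case: ifPn => t20 //.
- exact: f_nd.
- by rewrite (lt_le_trans t10 t12) in t20.
Qed.

Lemma integrable_pos_ndecr (a b : R) : 0 <= a ->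
  mu.-integrable `]a, b] (EFin \o f).
Proof.
move=> a0; apply: measurable_bounded_integrable => //.
- by rewrite /= lebesgue_measure_itv/=; case: ifP => // _; exact: ltry.
- exact: measurable_pos_ndecr.
- exists (f b); split; first exact: num_real.
  move=> y yb t /=; rewrite in_itv/= => /andP[at_ tb].
  rewrite ger0_norm//; apply: le_trans (ltW yb).
  by apply: f_nd => //; exact: le_lt_trans at_.
Qed.

Lemma Rintegral_pos_ndecrB (a b : R) : 0 <= a -> a <= b ->
  \int[mu]_(t in `]0, b]) f t - \int[mu]_(t in `]0, a]) f t =
  \int[mu]_(t in `]a, b]) f t.
Proof.
by move=> a0 ab; apply: Rintegral_itvB; [exact: integrable_pos_ndecr|
  rewrite bnd_simp|rewrite bnd_simp].
Qed.

Lemma Rintegral_pos_ndecr_le (a b : R) : 0 <= a -> a <= b ->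
  \int[mu]_(t in `]0, a]) f t <= \int[mu]_(t in `]0, b]) f t.
Proof.
by move=> a0 ab; rewrite -subr_ge0 Rintegral_pos_ndecrB//; exact: Rintegral_ge0.
Qed.

(** Between s and x the integrand is compared with the constant f s. The resulting supporting line
    replaces differentiability, f not being assumed continuous. *)
Lemma Rintegral_pos_ndecr_support (s x : R) : 0 < s -> 0 <= x ->
  \int[mu]_(t in `]0, s]) f t + f s * (x - s) <= \int[mu]_(t in `]0, x]) f t.
Proof.
move=> s0 x0; have [sx|xs] := leP s x.
  rewrite addrC -lerBrDr Rintegral_pos_ndecrB ?(ltW s0)// -Rintegral_cst_itv//.
  apply: le_Rintegral => //.
  - exact: integrable_cst_itv.
  - exact: integrable_pos_ndecr (ltW s0).
  - move=> t /=; rewrite in_itv/= => /andP[st _].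
    by rewrite f_nd// ltW.
rewrite -lerBrDl -opprB mulrN lerNl opprB.
rewrite Rintegral_pos_ndecrB ?(ltW xs)// -Rintegral_cst_itv ?(ltW xs)//.
apply: le_Rintegral => //.
- exact: integrable_pos_ndecr.
- exact: integrable_cst_itv.
- move=> t /=; rewrite in_itv/= => /andP[xt ts].
  by rewrite f_nd// (le_lt_trans x0).
Qed.

End primitive_of_nondecreasing.

(** * The function F along t = k'(s), and the tangent intercept D *)

Section Ffun_analysis.
Context {R : realType}.
Implicit Types x s t : R.

Definition dFfun t : R := expR (kfun (kprime_inv t)).

Lemma dFfun_kprime s : dFfun (kprime s) = Kfun s.
Proof. by rewrite /dFfun kprime_invK kfunE lnK// posrE Kfun_gt0. Qed.

Lemma dFfun_le t1 t2 : 0 < t1 -> t1 <= t2 -> dFfun t1 <= dFfun t2.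
Proof.
move=> t10 t12; have [s1 e1] := kprime_onto t10.
have [s2 e2] := kprime_onto (lt_le_trans t10 t12).
by move: t12; rewrite -e1 -e2 !dFfun_kprime ler_kprime ler_Kfun.
Qed.

Lemma dFfun_ge0 t : 0 <= dFfun t. Proof. exact: expR_ge0. Qed.

Lemma Ffun_ge0 x : 0 <= Ffun x.
Proof. by apply: Rintegral_ge0 => t _; exact: dFfun_ge0. Qed.

Lemma Ffun_le (a b : R) : 0 <= a -> a <= b -> Ffun a <= Ffun b.
Proof. exact: (Rintegral_pos_ndecr_le dFfun_le dFfun_ge0). Qed.

Lemma Ffun_support s x : 0 <= x ->
  Ffun (kprime s) + Kfun s * (x - kprime s) <= Ffun x.
Proof.
by move=> x0; rewrite -dFfun_kprime; apply: (Rintegral_pos_ndecr_support dFfun_le dFfun_ge0 (kprime_gt0 s) x0).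
Qed.

Local Opaque Ffun.

Lemma Ffun_lipschitz (b : R) : exists2 C : R, 0 < C & forall x y,
  0 <= x -> x <= y -> y <= b -> Ffun y <= Ffun x + C * (y - x).
Proof.
(* A parameter beyond those of all slopes of F on [0, b]; |b| + 1 is positive, hence a value of
   k'. *)
have [s es] : exists s : R, kprime s = `|b| + 1.
  by apply: kprime_onto; rewrite ltr_wpDl.
exists (Kfun s) => [|x y x0 xy yb]; first exact: Kfun_gt0.
have [y0|y0] := leP y 0.
  have -> : y = x by apply/eqP; rewrite eq_le xy andbT (le_trans y0).
  by rewrite subrr mulr0 addr0.
have [s' es'] := kprime_onto y0; have := Ffun_support s' x0; rewrite es' => h.
rewrite -lerBlDr -mulrN opprB; apply: le_trans h; rewrite lerD2l.
rewrite -[leRHS]opprK -mulrN opprB lerNr -mulrN opprB ler_wpM2r ?subr_ge0//.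
rewrite ler_Kfun -ler_kprime es es' (le_trans yb)// (le_trans (ler_norm _))//.
by rewrite lerDl.
Qed.

(** The supporting lines at two points squeeze the first-order remainder between 0 and (K1 - K0) (k1
    - k0). This allows F to be differentiated along k' from convexity and the continuity of K. *)
Lemma support_gap (F1 F0 k1 k0 K1 K0 : R) :
  F0 + K0 * (k1 - k0) <= F1 -> F1 + K1 * (k0 - k1) <= F0 ->
  `|F1 - F0 - K0 * (k1 - k0)| <= `|K1 - K0| * `|k1 - k0|.
Proof.
move=> h1 h2; rewrite -normrM [leLHS]ger0_norm; last by lra.
by apply: le_trans (ler_norm _); lra.
Qed.

Lemma is_derive_Ffun_kprime x :
  is_derive x 1 (fun t => Ffun (kprime t)) (Kfun x * (1 - Kfun1 x / Kfun x ^+ 2)).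
Proof.
have /is_derive1_caratheodory[r [rE cr rx]] := is_derive_kprime x.
pose h z := Ffun (kprime z) - Ffun (kprime x) - Kfun x * (kprime z - kprime x).
have h_le z : `|h z| <= `|Kfun z - Kfun x| * `|kprime z - kprime x|.
  have h1 := Ffun_support x (ltW (kprime_gt0 z)).
  have h2 := Ffun_support z (ltW (kprime_gt0 x)).
  exact: support_gap h1 h2.
(* Caratheodory's slope function of F(k') is K(x) times that of k' plus th, and th tends to 0 by the
   bound on h. *)
pose th z := if z == x then 0 else h z / (z - x).
have th_le z : `|th z| <= `|Kfun z - Kfun x| * `|r z|.
  rewrite /th; case: ifPn => zx; first by rewrite normr0 mulr_ge0.
  have zx0 : 0 < `|z - x| by rewrite normr_gt0 subr_eq0.
  rewrite normrM normfV ler_pdivrMr// -mulrA -normrM -rE; exact: h_le.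
apply/is_derive1_caratheodory; exists (fun z => Kfun x * r z + th z); split.
- move=> z; rewrite mulrDl -mulrA -rE /th; case: ifPn => [/eqP ->|zx].
    by rewrite !subrr mulr0 mul0r addr0.
  by rewrite divfK ?subr_eq0// [RHS]addrC; exact/esym/subrK.
- have thx : th x = 0 by rewrite /th eqxx.
  apply: cvgD; first by apply: cvgMr; exact: cr.
  rewrite thx; apply/cvgr0Pnorm_le => e e0.
  have b0 : (fun z => `|Kfun z - Kfun x| * `|r z|) @ x --> (0:R).
    rewrite (_ : 0 = `|Kfun x - Kfun x| * `|r x|); last by rewrite subrr normr0 mul0r.
    apply: cvgM; last exact: cvg_norm cr.
    apply: cvg_norm; apply: cvgB; last exact: cvg_cst.
    exact: is_derive1_continuous (is_derive_Kfun x).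
  move/cvgr0Pnorm_le : b0 => /(_ e e0); apply: filterS => z.
  by rewrite normrM !normr_id; exact: le_trans (th_le z).
- by rewrite rx /th eqxx addr0.
Qed.

(** The value at y = 0 of the tangent line to M(K(s), y) at y = K'(s), whose slope is 1. Seen as a
    function of K, it has slope - s and second derivative - 1 / K'. *)
Definition Dfun s : R := ln (Kfun s) + Ffun (kprime s) - Kfun1 s.

Lemma is_derive1_cst (c x : R) : is_derive x 1 (fun=> c) 0.
Proof. exact: is_derive_cst. Qed.

Lemma is_derive_Kfun1 x : is_derive x 1 Kfun1 (Kfun x + x * Kfun1 x).
Proof.
have := is_derive1D (is_derive1M (is_derive1_id x) (is_derive_Kfun x)) (is_derive1_cst 1 x).
by move=> /is_derive_eq; apply; rewrite mul1r addr0.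
Qed.

Lemma is_derive_Dfun x : is_derive x 1 Dfun (- x * Kfun1 x).
Proof.
have K0 := Kfun_gt0 x.
have := is_derive1B (is_derive1D (is_derive1_ln_comp K0 (is_derive_Kfun x))
  (is_derive_Ffun_kprime x)) (is_derive_Kfun1 x).
by move=> /is_derive_eq; apply; field; rewrite gt_eqF.
Qed.

(** The quantity is K'', and K K'' = K'^2 + (K^2 - K') because K' = x K + 1. *)
Lemma Kfun2_gt0 x : 0 < Kfun x + x * Kfun1 x.
Proof.
rewrite -(pmulr_rgt0 _ (Kfun_gt0 x)).
rewrite (_ : Kfun x * _ = Kfun1 x ^+ 2 + (Kfun x ^+ 2 - Kfun1 x)).
  by rewrite ltr_pwDr ?subr_gt0 ?Kfun1_lt_sqr ?sqr_ge0.
by rewrite /Kfun1; ring.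
Qed.

Lemma ler_Kfun1 : {homo @Kfun1 R : x y / x <= y}.
Proof.
move=> x y xy; apply: (le_derive_ndecr xy is_derive_Kfun1) => z _.
exact/ltW/Kfun2_gt0.
Qed.

(** For points z left of s0: h = s0 - z, kc is the mean slope of K on [z, s0], ka bounds K' from
    below and La bounds K'' from above. The excess h (k0 - kc) / k0 is at most La h^2 / ka, and kc
    >= ka turns this into a multiple of (kc h)^2. *)
Lemma taylor_gap (ka k0 kz kc La Ld h : R) : 0 < ka -> 0 < k0 -> ka <= kz ->
  ka <= k0 -> kz <= kc -> 0 <= La -> 0 <= h -> k0 = kz + Ld * h -> Ld <= La ->
  0 <= - (h + - (kc * h) / k0 + 3 * - (La / ka ^+ 3 / 3) * (kc * h) ^+ 2).
Proof.
move=> ka0 k00 kaz kak0 kzc La0 h0 e LdLa.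
have h1 : 0 <= (kc - k0 + La * h) * h / k0.
  rewrite divr_ge0 ?(ltW k00)// mulr_ge0//.
  have : Ld * h <= La * h by rewrite ler_wpM2r.
  by lra.
have h2 : La * h ^+ 2 / ka <= La / ka ^+ 3 * (kc * h) ^+ 2.
  rewrite [leRHS](_ : _ = La * h ^+ 2 / ka * (kc / ka) ^+ 2); last by field; rewrite gt_eqF.
  rewrite ler_peMr//; first by rewrite divr_ge0 ?(ltW ka0)// mulr_ge0 ?sqr_ge0.
  by rewrite exprn_ege1// ler_pdivlMr// mul1r (le_trans kaz).
have h3 : La * h ^+ 2 / k0 <= La * h ^+ 2 / ka.
  by rewrite ler_wpM2l ?mulr_ge0 ?sqr_ge0// lef_pV2.
have h4 : (kc - k0 + La * h) * h / k0 = kc * h / k0 - h + La * h ^+ 2 / k0.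
  by field; rewrite gt_eqF.
rewrite h4 in h1.
rewrite mulNr [X in 3 * X * _](_ : _ = - (La / ka ^+ 3) / 3); last by rewrite mulNr.
rewrite [X in _ + X](_ : _ = - (La / ka ^+ 3 * (kc * h) ^+ 2)); last first.
  by field; rewrite gt_eqF.
by lra.
Qed.

(** A second-order Taylor bound for D in the variable K, with cubic error, uniform for parameters in
    [A, B]. *)
Lemma Dfun_lower (A B : R) : exists2 C : R, 0 < C & forall s s0,
  A <= s <= B -> A <= s0 <= B ->
  Dfun s0 - s0 * (Kfun s - Kfun s0) - (Kfun s - Kfun s0) ^+ 2 / (2 * Kfun1 s0)
    - C * `|Kfun s - Kfun s0| ^+ 3 <= Dfun s.
Proof.
(* On [A, B] one has K' >= ka and K'' <= La; the 3 in the constant below cancels the derivative of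
   the cube. *)
pose ka := Kfun1 A; have ka0 : 0 < ka by exact: Kfun1_gt0.
pose La := Kfun B + `|B| * Kfun1 B.
have La0 : 0 < La by rewrite ltr_pwDl ?Kfun_gt0// mulr_ge0// ltW// Kfun1_gt0.
exists (La / ka ^+ 3 / 3) => [|s s0 /andP[As sB] /andP[As0 s0B]].
  by rewrite !divr_gt0 ?exprn_gt0.
set C := (La / _ / _); have C0 : 0 < C by rewrite !divr_gt0 ?exprn_gt0.
have k0 : 0 < Kfun1 s0 by exact: Kfun1_gt0.
pose h c z := Dfun z + s0 * Kfun z + (Kfun z - Kfun s0) ^+ 2 / (2 * Kfun1 s0)
    + c * (Kfun z - Kfun s0) ^+ 3.
pose dh c z := Kfun1 z * (s0 - z + (Kfun z - Kfun s0) / Kfun1 s0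
    + 3 * c * (Kfun z - Kfun s0) ^+ 2).
have hdh (c z : R) : is_derive z 1 (h c) (dh c z).
  have dK : is_derive z 1 (fun z => Kfun z - Kfun s0) (Kfun1 z).
    by have := is_derive1B (is_derive_Kfun z) (is_derive1_cst (Kfun s0) z); rewrite subr0.
  have dK2 := is_derive1M dK dK; have dK3 := is_derive1M dK2 dK.
  have := is_derive1D (is_derive1D (is_derive1D (is_derive_Dfun z)
    (is_derive1M (is_derive1_cst s0 z) (is_derive_Kfun z)))
    (is_derive1M dK2 (is_derive1_cst (2 * Kfun1 s0)^-1 z)))
    (is_derive1M (is_derive1_cst c z) dK3).
  rewrite (_ : (fun _ => _) = h c); last by apply/funext => y; rewrite /h !exprS !expr0 !mulr1 !mulrA.
  by move=> /is_derive_eq; apply; rewrite /dh; field; rewrite gt_eqF.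
have hs0 c : h c s0 = Dfun s0 + s0 * Kfun s0.
  by rewrite /h subrr !expr0n/= mul0r mulr0 !addr0.
(* Right of s0, convexity of K gives K(z) - K(s0) >= K'(s0) (z - s0), hence a nonnegative derivative
   of h. Left of s0 that term has the unfavourable sign and the cube is negative, so the coefficient
   is - C and [taylor_gap] pays the difference. *)
have [ss0|/ltW ss0] := leP s0 s.
  have : h C s0 <= h C s.
    apply: (le_derive_ndecr ss0 (hdh C)) => z /andP[sz zs].
    apply: mulr_ge0; first exact/ltW/Kfun1_gt0.
    apply: addr_ge0; last by rewrite mulr_ge0 ?sqr_ge0// mulr_ge0 ?ltW.
    rewrite -[s0 - z]opprB addrC subr_ge0 ler_pdivlMr// mulrC.
    have [c /andP[sc _] ->] := derive_mean_value sz is_derive_Kfun.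
    by rewrite ler_wpM2r ?subr_ge0// ler_Kfun1.
  rewrite hs0 /h ger0_norm; last by rewrite subr_ge0 ler_Kfun.
  by lra.
have : h (- C) s0 <= h (- C) s.
  rewrite -lerN2; apply: (le_derive_ndecr ss0 (fun z => is_deriveN (hdh (- C) z))).
  move=> z /andP[sz zs]; rewrite -mulrN; apply: mulr_ge0; first exact/ltW/Kfun1_gt0.
  have Az := le_trans As sz; have zB := le_trans zs s0B.
  have [c /andP[zc _] eK] := derive_mean_value zs is_derive_Kfun.
  have [d /andP[zd ds0] eK1] := derive_mean_value zs is_derive_Kfun1.
  have kz : ka <= Kfun1 z by exact: ler_Kfun1.
  have kc : Kfun1 z <= Kfun1 c by exact: ler_Kfun1.
  have dLa : Kfun d + d * Kfun1 d <= La.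
    have dB := le_trans ds0 s0B.
    apply: lerD; first by rewrite ler_Kfun.
    apply: (@le_trans _ _ (`|B| * Kfun1 d)).
      apply: ler_wpM2r; first exact/ltW/Kfun1_gt0.
      exact: le_trans dB (ler_norm B).
    by rewrite ler_wpM2l// ler_Kfun1.
  rewrite -[Kfun z - Kfun s0]opprB eK sqrrN.
  apply: (taylor_gap ka0 k0 kz _ kc (ltW La0) _ _ dLa); last by rewrite -eK1 addrC subrK.
  - exact: ler_Kfun1.
  - by rewrite subr_ge0.
rewrite hs0 /h ler0_norm; last by rewrite subr_le0 ler_Kfun.
set K := Kfun s - Kfun s0; rewrite (_ : (- K) ^+ 3 = - K ^+ 3); last by ring.
by rewrite /K; lra.
Qed.

End Ffun_analysis.

(** * The function M and its support inequality *)

Section Mfun.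
Context {R : realType}.
Implicit Types a y : R.
Local Opaque Kfun kprime Ffun.

Definition Mfun a y : R := ln a + Ffun (y / a).

Lemma Mfun_le a y1 y2 : 0 < a -> 0 <= y1 -> y1 <= y2 -> Mfun a y1 <= Mfun a y2.
Proof.
move=> a0 y10 y12; rewrite lerD2l; apply: Ffun_le.
  by rewrite divr_ge0// ltW.
by rewrite ler_wpM2r// invr_ge0 ltW.
Qed.

Lemma ln_le_Mfun a y : ln a <= Mfun a y.
Proof. by rewrite lerDl; exact: Ffun_ge0. Qed.

Lemma Mfun_param (c s : R) : 0 < c ->
  Mfun (c * Kfun s) (c * Kfun1 s) = ln c + Kfun1 s + Dfun s.
Proof.
move=> c0; have K0 := Kfun_gt0 s.
rewrite /Mfun (_ : c * Kfun1 s / _ = kprime s).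
  by rewrite lnM ?posrE// /Dfun; ring.
by rewrite kprimeE; field; rewrite !gt_eqF.
Qed.

(** M is convex in y; this is its tangent line at y = c K'(s), where the slope is 1 / c. *)
Lemma Mfun_ge_param (c s y : R) : 0 < c -> 0 <= y ->
  ln c + y / c + Dfun s <= Mfun (c * Kfun s) y.
Proof.
move=> c0 y0; have K0 := Kfun_gt0 s.
have cK0 : 0 < c * Kfun s by rewrite mulr_gt0.
have h := @Ffun_support _ s (y / (c * Kfun s)) (divr_ge0 y0 (ltW cK0)).
rewrite /Mfun lnM ?posrE// /Dfun.
have e : Kfun s * (y / (c * Kfun s) - kprime s) = y / c - Kfun1 s.
  by rewrite kprimeE; field; rewrite !gt_eqF.
rewrite e in h; move: (ln c) (ln (Kfun s)) (Ffun (kprime s)) (Kfun1 s) h => p q r t.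
by move: (Ffun _) (y / c) => v w; lra.
Qed.

(* In the coordinates a = c K(s), b = c K'(s) the partial derivatives of Mfun
   are -s/c and 1/c.  The term (a - a0)^2 / (2 b0) is the degeneracy
   M_yy (M_aa + M_y / y) = M_ay^2 of the Hessian. *)
Lemma Mfun_support (m L be : R) : 0 < m -> m <= L -> 0 < be -> be <= L ->
  exists2 C : R, 0 < C & forall a0 b0, m <= a0 <= L -> be <= b0 <= L ->
  exists s0 ic : R, 0 < ic <= C /\ forall a y, m <= a <= L -> 0 <= y ->
  Mfun a0 b0 + ic * (y - b0 - s0 * (a - a0) - (a - a0) ^+ 2 / (2 * b0))
    - C * `|a - a0| ^+ 3 <= Mfun a y.
Proof.
move=> m0 mL be0 beL; have L0 := lt_le_trans m0 mL.
(* As b0 / a0 lies in [be / L, L / m], K(s0) lies in [K(S1), K(S2)]; hence a / c = a K(s0) / a0 lies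
   in [K(S3), K(S4)] for every a in [m, L]. *)
have [S1 eS1] := kprime_onto (divr_gt0 be0 L0).
have [S2 eS2] := kprime_onto (divr_gt0 L0 m0).
have K1 := Kfun_gt0 S1; have K2 := Kfun_gt0 S2.
have [S3 eS3] : exists s, Kfun s = m * Kfun S1 / L.
  by apply: Kfun_onto; rewrite divr_gt0// mulr_gt0.
have [S4 eS4] : exists s, Kfun s = L * Kfun S2 / m.
  by apply: Kfun_onto; rewrite divr_gt0// mulr_gt0.
have [C0 C00 HC0] := @Dfun_lower R S3 S4.
(* The number q bounds 1 / c; since K(s) - K(s0) = (a - a0) / c, the cubic error of D costs at most
   C0 q^3 |a - a0|^3. *)
pose q := Kfun S2 / m; have q0 : 0 < q by rewrite divr_gt0.
have C0q : 0 <= C0 * q ^+ 3 by rewrite mulr_ge0 ?exprn_ge0// ltW.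
exists (q + C0 * q ^+ 3) => [|a0 b0 /andP[ma0 a0L] /andP[bb0 b0L]].
  exact: ltr_wpDr.
have a00 := lt_le_trans m0 ma0; have b00 := lt_le_trans be0 bb0.
have [s0 es0] := kprime_onto (divr_gt0 b00 a00).
have K0 := Kfun_gt0 s0; have ca0 : 0 < a0 / Kfun s0 by rewrite divr_gt0.
(* The same c is kept when a varies. Along a curve of constant c the slope in y stays 1 / c, which
   is the degenerate direction of the Hessian, and only D(s) remains to be expanded. *)
pose c := a0 / Kfun s0.
have c0 : 0 < c by [].
have Ks0 : Kfun S1 <= Kfun s0 <= Kfun S2.
  rewrite !ler_Kfun -(ler_kprime S1) -(ler_kprime s0 S2) es0 eS1 eS2; apply/andP; split.
    by apply: ler_pM; rewrite ?invr_ge0 ?(ltW be0) ?(ltW L0)// lef_pV2.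
  by apply: ler_pM; rewrite ?invr_ge0 ?(ltW b00) ?(ltW a00)// lef_pV2.
have icq : c^-1 <= q.
  rewrite /c invf_div /q; apply: ler_pM; rewrite ?invr_ge0 ?(ltW K0) ?(ltW a00)//.
    by case/andP: Ks0.
  by rewrite lef_pV2.
have rng a : m <= a <= L -> exists2 s, a = c * Kfun s & S3 <= s <= S4.
  move=> /andP[ma aL]; have a_0 := lt_le_trans m0 ma.
  have [s es] := Kfun_onto (divr_gt0 a_0 c0).
  exists s; first by rewrite es mulrC divfK// gt_eqF.
  rewrite -(ler_Kfun S3) -(ler_Kfun s S4) es eS3 eS4 /c invf_div; apply/andP; split.
    rewrite -mulrA; apply: ler_pM; rewrite ?(ltW m0) ?divr_ge0 ?(ltW L0) ?(ltW K1)//.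
    by apply: ler_pM; rewrite ?invr_ge0 ?(ltW L0) ?(ltW K1) ?lef_pV2//; case/andP: Ks0.
  rewrite -mulrA; apply: ler_pM; rewrite ?(ltW a_0) ?divr_ge0 ?(ltW a00) ?(ltW K0)//.
  by apply: ler_pM; rewrite ?invr_ge0 ?(ltW a00) ?(ltW K0) ?lef_pV2//; case/andP: Ks0.
have ea0 : a0 = c * Kfun s0 by rewrite /c divfK// gt_eqF.
have eb0 : b0 = c * Kfun1 s0.
  have -> : Kfun1 s0 = Kfun s0 * kprime s0.
    by rewrite kprimeE mulrC divfK// gt_eqF.
  by rewrite es0 /c; field; rewrite !gt_eqF.
have [s0' ea0' s0r] := rng a0 (introT andP (conj ma0 a0L)).
have s0E : s0' = s0.
  apply: (inc_inj (@ler_Kfun R)); apply: (mulfI (lt0r_neq0 c0)).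
  by rewrite -ea0'.
rewrite s0E in s0r.
exists s0, c^-1; split; first by rewrite invr_gt0 c0 (le_trans icq)// lerDl.
move=> a y mal y0; have [s -> sr] := rng a mal.
apply: le_trans (Mfun_ge_param s c0 y0).
have := HC0 s s0 sr s0r; rewrite ea0 eb0 Mfun_param// -!mulrBr normrM (gtr0_norm c0).
set X := Kfun s - Kfun s0 => HD.
have k10 := Kfun1_gt0 s0.
have -> : c^-1 * (y - c * Kfun1 s0 - s0 * (c * X) - (c * X) ^+ 2 / (2 * (c * Kfun1 s0)))
   = y / c - Kfun1 s0 - s0 * X - X ^+ 2 / (2 * Kfun1 s0).
  by field; rewrite !gt_eqF.
have : C0 * `|X| ^+ 3 <= (q + C0 * q ^+ 3) * (c * `|X|) ^+ 3.
  have cX0 : 0 <= c * `|X| by apply: mulr_ge0 => //; exact: ltW.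
  have qX0 : 0 <= q * (c * `|X|) by apply: mulr_ge0 => //; exact: ltW.
  apply: (@le_trans _ _ (C0 * q ^+ 3 * (c * `|X|) ^+ 3)).
    rewrite -mulrA -exprMn; apply: ler_wpM2l; first exact: ltW.
    rewrite lerXn2r ?nnegrE//.
    rewrite mulrA -[leLHS]mul1r ler_wpM2r//.
    by rewrite -(mulVf (lt0r_neq0 c0)) ler_wpM2r// ltW.
  rewrite ler_wpM2r ?exprn_ge0//.
  by rewrite lerDr ltW.
move: HD; move: (X ^+ 2 / _) (C0 * `|X| ^+ 3) ((q + _) * _) (s0 * X) => x1 x2 x3 x4.
by move: (Dfun s) (Dfun s0) (Kfun1 s0) (ln c) (y / c) => x5 x6 x7 x8 x9; lra.
Qed.

End Mfun.

(** * Normal densities and their convolution *)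

Section normal_integral.
Context {R : realType}.
Local Notation mu := (@lebesgue_measure R).
Local Notation gam := (@normal_prob R 0 1).
Local Open Scope ereal_scope.

(** The Radon-Nikodym derivative agrees almost everywhere with the explicit density, as both have
    the same integral over every measurable set. *)
Lemma ge0_integral_normal_prob (m s : R) (f : R -> \bar R) :
  (forall x, 0 <= f x) -> measurable_fun setT f ->
  \int[normal_prob m s]_x f x = \int[mu]_x (f x * (normal_pdf m s x)%:E).
Proof.
move=> f0 mf.
have dom := normal_prob_dominates m s.
rewrite -(Radon_Nikodym_SigmaFinite.change_of_variables dom f0 measurableT mf).
apply: ae_eq_integral => //.
- apply: emeasurable_funM => //.
  exact: measurable_int (Radon_Nikodym_SigmaFinite.f_integrable dom).
- apply: emeasurable_funM => //; apply/measurable_EFinP.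
  exact: measurable_normal_pdf.
- apply: ae_eqe_mul2l; apply: integral_ae_eq => //.
  + exact: Radon_Nikodym_SigmaFinite.f_integrable.
  + by apply/measurable_EFinP; exact: measurable_normal_pdf.
  + by move=> A AT mA; rewrite -Radon_Nikodym_SigmaFinite.f_integral.
Qed.

Lemma normal_pdfE1 (m s x : R) : (0 < s)%R ->
  normal_pdf m s x = (expR (- ((x - m) / s) ^+ 2 / 2) / (s * Num.sqrt (pi *+ 2)))%R.
Proof.
move=> s0; rewrite normal_pdfE ?gt_eqF// /normal_peak /normal_fun.
rewrite -mulrnAr sqrtrM ?sqr_ge0// sqrtr_sqr gtr0_norm// mulrC; congr (expR _ / _)%R.
by field; rewrite gt_eqF.
Qed.

Lemma ge0_integral_affine_normal (m b : R) (h : R -> R) : (0 < b)%R ->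
  continuous h -> (forall x, 0 <= h x)%R ->
  \int[mu]_z (h (m + b * z) * normal_pdf 0 1 z)%:E =
  \int[mu]_r (h r * normal_pdf m b r)%:E.
Proof.
move=> b0 ch h0; pose F (z : R) : R := (m + b * z)%R.
pose G r : R := (h r * normal_pdf m b r)%R.
have dF (z : R) : is_derive z (1 : R)%R F b.
  have := is_derive1D (is_derive1_cst m z) (is_derive1M (is_derive1_cst b z) (is_derive1_id z)).
  by move=> /is_derive_eq; apply; rewrite add0r mul0r add0r mulr1.
have F'E : F^`()%classic = cst b.
  by apply/funext => z; rewrite derive1E; have [_ ->] := dF z.
have b0' : b != 0%R by rewrite gt_eqF.
have cG : continuous G.
  by move=> x; apply: cvgM; [exact: ch|exact: continuous_normal_pdf].
have G0 x : (0 <= G x)%R by rewrite mulr_ge0 ?h0 ?normal_pdf_ge0.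
have F_homo : {homo F : x y / (x < y)%R} by move=> x y xy; rewrite ltrD2l ltr_pM2l.
have F'c : continuous F^`()%classic by rewrite F'E => x; exact: cvg_cst.
have F'cvgNy : cvg (F^`()%classic x @[x --> -oo%R]) by rewrite F'E; exact: is_cvg_cst.
have F'cvgy : cvg (F^`()%classic x @[x --> +oo%R]) by rewrite F'E; exact: is_cvg_cst.
have Fd x : derivable F x 1%R by have [] := dF x.
have FNy : F x @[x --> -oo%R] --> -oo%R.
  by apply: cvg_comp (cvg_addrl_Ny m); apply: gt0_cvgMrNy => //; exact: cvg_id.
have Fy : F x @[x --> +oo%R] --> +oo%R.
  by apply: cvg_comp (cvg_addrl m); apply: gt0_cvgMry => //; exact: cvg_id.
have -> := increasing_ge0_integration_by_substitutionT F_homo F'c F'cvgNy F'cvgy Fd FNy Fy cG G0.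
rewrite F'E; apply: eq_integral => z _; congr EFin.
rewrite !fctE /G /F -mulrA; congr (_ * _)%R.
rewrite !normal_pdfE1// subr0 divr1 mul1r (addrC m) addrK.
rewrite (mulrC b) mulfK//; field.
by rewrite b0'/= gt_eqF// sqrtr_gt0 pmulrn_lgt0// pi_gt0.
Qed.

(** Bayes' formula for r = a z + b y with independent standard z and y: given r, the variable z is
    normal with mean a r / c^2 and deviation b / c. *)
Lemma normal_pdf_conv (a b c z r : R) : (0 < b)%R -> (0 < c)%R ->
  (a ^+ 2 + b ^+ 2 = c ^+ 2)%R ->
  (normal_pdf 0 1 z * normal_pdf (a * z) b r =
   normal_pdf (a * r / c ^+ 2) (b / c) z * normal_pdf 0 c r)%R.
Proof.
move=> b0 c0 abc; rewrite !normal_pdfE1 ?divr_gt0//.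
have s0 : (0 < Num.sqrt (pi *+ 2) :> R)%R by rewrite sqrtr_gt0 pmulrn_lgt0// pi_gt0.
rewrite mulrACA [RHS]mulrACA -!expRD -!invfM; congr (expR _ / _)%R; last first.
  by field; rewrite gt_eqF.
apply/eqP; rewrite -subr_eq0; apply/eqP.
rewrite (_ : (_ - _)%R = ((c ^+ 2 - (a ^+ 2 + b ^+ 2)) * (z ^+ 2 - (r / c) ^+ 2) / b ^+ 2 / 2))%R.
  by rewrite abc subrr !mul0r.
by field; rewrite !gt_eqF.
Qed.

(** By Tonelli the integral over z may be taken first, and the conditional density of z given r
    integrates to 1. *)
Lemma integral_normal_pdf_conv (a b c : R) (h : R -> R) : (0 < b)%R -> (0 < c)%R ->
  (a ^+ 2 + b ^+ 2 = c ^+ 2)%R -> continuous h -> (forall x, 0 <= h x)%R ->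
  \int[gam]_z \int[gam]_y (h (a * z + b * y))%:E = \int[gam]_z (h (c * z))%:E.
Proof.
move=> b0 c0 abc ch h0.
have mh : measurable_fun setT h by exact: continuous_measurable_fun.
have gamE (m s : R) : (0 < s)%R ->
    \int[gam]_y (h (m + s * y))%:E = \int[mu]_r (h r * normal_pdf m s r)%:E.
  move=> s0; rewrite ge0_integral_normal_prob.
  - by rewrite -ge0_integral_affine_normal.
  - by move=> x; rewrite lee_fin.
  - apply/measurable_EFinP/measurableT_comp => //; exact: measurable_funD.
under eq_integral do rewrite gamE//.
have mg : measurable_fun setT (fun zr : R * R =>
    (h zr.2 * normal_pdf (a * zr.1) b zr.2)%R).
  apply: measurable_funM; first exact: measurableT_comp.
  rewrite (_ : (fun _ => _) = (fun zr : R * R => normal_pdf 0 b (zr.2 - a * zr.1)%R)).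
    apply: measurableT_comp; first exact: measurable_normal_pdf.
    by apply: measurable_funB => //; apply: measurable_funM.
  by apply/funext => zr; rewrite !normal_pdfE1// subr0.
have mf : measurable_fun setT (fun zr : R * R =>
    (normal_pdf 0 1 zr.1 * (h zr.2 * normal_pdf (a * zr.1) b zr.2))%:E).
  apply/measurable_EFinP; apply: measurable_funM => //.
  by apply: measurableT_comp => //; exact: measurable_normal_pdf.
rewrite [LHS]ge0_integral_normal_prob; last 2 first.
- by move=> z; apply: integral_ge0 => r _; rewrite lee_fin mulr_ge0 ?normal_pdf_ge0.
- apply: (@measurable_fun_fubini_tonelli_F _ _ _ _ _ mu
    (fun zr : R * R => (h zr.2 * normal_pdf (a * zr.1) b zr.2)%:E)).
  + exact/measurable_EFinP.
  + by move=> zr; rewrite lee_fin mulr_ge0 ?normal_pdf_ge0.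
transitivity (\int[mu]_z \int[mu]_r
    (normal_pdf 0 1 z * (h r * normal_pdf (a * z) b r))%:E).
  apply: eq_integral => z _; rewrite muleC -ge0_integralZl//.
  - apply/measurable_EFinP/measurable_funM => //.
    exact: measurable_normal_pdf.
  - by move=> r _; rewrite lee_fin mulr_ge0 ?normal_pdf_ge0.
  - by rewrite lee_fin normal_pdf_ge0.
have f0 (zr : R * R) : 0 <= (normal_pdf 0 1 zr.1 * (h zr.2 * normal_pdf (a * zr.1) b zr.2))%:E.
  by rewrite lee_fin !mulr_ge0 ?normal_pdf_ge0.
apply: (etrans (@fubini_tonelli _ _ _ _ R mu mu _ mf f0)) => /=.
under [RHS]eq_integral do rewrite -[(c * _)%R]add0r.
rewrite gamE//; apply: eq_integral => r _.
transitivity (\int[mu]_z ((h r * normal_pdf 0 c r)%:E * (normal_pdf (a * r / c ^+ 2) (b / c) z)%:E)).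
  apply: eq_integral => z _; rewrite -EFinM; congr EFin.
  by rewrite mulrCA (normal_pdf_conv _ _ b0 c0 abc); ring.
rewrite ge0_integralZl//.
- by rewrite integral_normal_pdf mule1.
- by apply/measurable_EFinP; exact: measurable_normal_pdf.
- by move=> z _; rewrite lee_fin normal_pdf_ge0.
- by rewrite lee_fin mulr_ge0 ?normal_pdf_ge0.
Qed.

End normal_integral.

(** * Integrability and moments under the standard Gaussian measure *)

Section gaussian_expectation.
Context {R : realType}.
Local Notation mu := (@lebesgue_measure R).
Local Notation gam := (@normal_prob R 0 1).
Implicit Types (u v : R -> R).

Lemma normal_prob_setT : gam setT = 1%E.
Proof. exact: (@probability_setT _ _ _ (normal_prob 0 1)). Qed.

Definition gint v := gam.-integrable setT (EFin \o v).

Definition gE v : R := \int[gam]_z v z.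

Lemma gint_bounded v (B : R) : measurable_fun setT v -> (forall z, `|v z| <= B) -> gint v.
Proof.
move=> mv vB; apply: measurable_bounded_integrable => //.
- by rewrite [ltLHS]normal_prob_setT ltry.
- exists B; split; first exact: num_real.
  by move=> y By z _; exact: le_trans (vB z) (ltW By).
Qed.

Lemma gint_cst (c : R) : gint (fun=> c).
Proof. by apply: (@gint_bounded _ `|c|). Qed.

Lemma gintD u v : gint u -> gint v -> gint (fun z => u z + v z).
Proof. by move=> iu iv; have := integrableD measurableT iu iv. Qed.

Lemma gintB u v : gint u -> gint v -> gint (fun z => u z - v z).
Proof. by move=> iu iv; have := integrableB measurableT iu iv. Qed.

Lemma gintZ (c : R) v : gint v -> gint (fun z => c * v z).
Proof. by move=> iv; have := integrableZl measurableT c iv. Qed.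

Lemma gint_le u v : measurable_fun setT u -> (forall z, `|u z| <= v z) ->
  gint v -> gint u.
Proof.
move=> mu_ uv; apply: le_integrable => //; first exact/measurable_EFinP.
by move=> z _; rewrite lee_fin (le_trans (uv z))// ler_norm.
Qed.

Lemma gE_cst (c : R) : gE (fun=> c) = c.
Proof. by rewrite /gE Rintegral_cst// [X in fine X]normal_prob_setT mulr1. Qed.

Lemma gED u v : gint u -> gint v -> gE (fun z => u z + v z) = gE u + gE v.
Proof. by move=> iu iv; rewrite /gE RintegralD. Qed.

Lemma gEB u v : gint u -> gint v -> gE (fun z => u z - v z) = gE u - gE v.
Proof. by move=> iu iv; rewrite /gE RintegralB. Qed.

Lemma gEZ (c : R) v : gint v -> gE (fun z => c * v z) = c * gE v.
Proof. by move=> iv; rewrite /gE RintegralZl. Qed.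

Lemma gE_le u v : gint u -> gint v -> (forall z, u z <= v z) -> gE u <= gE v.
Proof. by move=> iu iv uv; apply: le_Rintegral. Qed.

Lemma gE_ge0 v : (forall z, 0 <= v z) -> 0 <= gE v.
Proof. by move=> v0; apply: Rintegral_ge0. Qed.

Lemma gE_norm v : gint v -> `|gE v| <= gE (fun z => `|v z|).
Proof. by move=> iv; apply: le_normr_Rintegral. Qed.

Lemma gE_bounded v (a b : R) : gint v -> (forall z, a <= v z <= b) -> a <= gE v <= b.
Proof.
move=> iv vab; apply/andP; split.
- by rewrite -[leLHS]gE_cst; apply: gE_le (gint_cst a) iv _ => z; case/andP: (vab z).
- by rewrite -[leRHS]gE_cst; apply: gE_le iv (gint_cst b) _ => z; case/andP: (vab z).
Qed.

Lemma gint_norm v : gint v -> gint (fun z => `|v z|).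
Proof. by move=> iv; have := integrable_norm iv. Qed.

Lemma gE_norm_le v (B : R) : gint v -> (forall z, `|v z| <= B) -> `|gE v| <= B.
Proof.
move=> iv vB; apply: le_trans (gE_norm iv) _; rewrite -[leRHS]gE_cst.
by apply: gE_le (gint_norm iv) (gint_cst B) vB.
Qed.

Lemma gE_fin v : gint v -> (\int[gam]_z (v z)%:E)%E = (gE v)%:E.
Proof. by move=> iv; rewrite /gE /Rintegral fineK//; apply: integrable_fin_num. Qed.

Lemma integral_expR_normal (l : R) :
  (\int[gam]_z (expR (l * z))%:E)%E = (expR (l ^+ 2 / 2))%:E.
Proof.
rewrite ge0_integral_normal_prob; last 2 first.
- by move=> x; rewrite lee_fin expR_ge0.
- by apply/measurable_EFinP/measurableT_comp => //; exact: measurable_funM.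
transitivity (\int[mu]_z ((expR (l ^+ 2 / 2))%:E * (normal_pdf l 1 z)%:E))%E.
  apply: eq_integral => z _; rewrite -!EFinM; congr EFin.
  rewrite !normal_pdfE1// !mulrA -!expRD; congr (expR _ / _).
  by rewrite !divr1; field.
rewrite ge0_integralZl//.
- by rewrite integral_normal_pdf mule1.
- by apply/measurable_EFinP; exact: measurable_normal_pdf.
- by move=> z _; rewrite lee_fin normal_pdf_ge0.
Qed.

Lemma gint_expR (l : R) : gint (fun z => expR (l * z)).
Proof.
apply/integrableP; split.
  by apply/measurable_EFinP/measurableT_comp => //; exact: measurable_funM.
under eq_integral do rewrite /= ger0_norm ?expR_ge0//.
by rewrite integral_expR_normal ltry.
Qed.

Lemma gE_expR (l : R) : gE (fun z => expR (l * z)) = expR (l ^+ 2 / 2).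
Proof. by rewrite /gE /Rintegral integral_expR_normal. Qed.

Lemma expR_ge1Dx2 (y : R) : 0 <= y -> 1 + y + y ^+ 2 / 2 <= expR y.
Proof.
move=> y0; pose f (t : R) : R := expR t - (1 + t + t ^+ 2 / 2).
have fd (t : R) : is_derive t 1 f (expR t - (1 + t)).
  have := is_derive1B (is_derive_expR t) (is_derive1D (is_derive1D
    (is_derive1_cst 1 t) (is_derive1_id t)) (is_derive_half_sqr t)).
  by move=> /is_derive_eq; apply; rewrite add0r.
have : f 0 <= f y.
  by apply: (le_derive_ndecr y0 fd) => t _; rewrite subr_ge0 expR_ge1Dx.
by rewrite /f expR0 expr0n/= mul0r !addr0 subrr subr_ge0.
Qed.

(** With x = 2 y the right-hand side is (E - 1 / E)^2, E = e^y, and E - 1 / E >= 2 y amounts to (E -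
    y)^2 >= 1 + y^2, which follows from E >= 1 + y + y^2 / 2. *)
Lemma sqr_le_cosh (x : R) : x ^+ 2 <= expR x + expR (- x) - 2.
Proof.
wlog x0 : x / 0 <= x.
  move=> h; have [/h//|/ltW x0] := leP 0 x.
  by have := h (- x); rewrite sqrrN opprK (addrC (expR (- x))); apply; rewrite oppr_ge0.
pose y := x / 2; have y0 : 0 <= y by rewrite divr_ge0.
have -> : x = y + y by rewrite /y -splitr.
rewrite opprD !expRD; set E := expR y; have E0 : 0 < E by exact: expR_gt0.
have -> : expR (- y) = E^-1 by rewrite expRN.
have E1 : 1 + y + y ^+ 2 / 2 <= E.
  exact: expR_ge1Dx2.
have h : 2 * y <= E - E^-1.
  rewrite -subr_ge0 -(pmulr_lge0 _ E0).
  have -> : (E - E^-1 - 2 * y) * E = (E - y) ^+ 2 - 1 - y ^+ 2.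
    by field; rewrite gt_eqF.
  by have : (1 + y ^+ 2 / 2) ^+ 2 <= (E - y) ^+ 2;
    [rewrite ler_sqr ?nnegrE; nra|nra].
have -> : E * E + E^-1 * E^-1 - 2 = (E - E^-1) ^+ 2 by field; rewrite gt_eqF.
rewrite -mulr2n -mulr_natl ler_sqr ?nnegrE ?mulr_ge0//.
by rewrite (le_trans _ h)// mulr_ge0.
Qed.

Lemma pow4_le_cosh (x : R) : x ^+ 4 <= 24 * (expR x + expR (- x)).
Proof.
wlog x0 : x / 0 <= x.
  move=> h; have [/h//|/ltW x0] := leP 0 x.
  have := h (- x); rewrite opprK (addrC (expR (- x))) => h'.
  have -> : x ^+ 4 = (- x) ^+ 4 by ring.
  by apply: h'; rewrite oppr_ge0.
have := @expR_ge1Dxn _ x 3 x0; have := expR_gt0 (- x).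
by rewrite (_ : 4`! = 24)%N//; lra.
Qed.

Lemma measurable_exprn_fun n : measurable_fun setT (fun z : R => z ^+ n).
Proof. by apply: continuous_measurable_fun; exact: exprn_continuous. Qed.

Lemma gint_pow4 : gint (fun z => z ^+ 4).
Proof.
apply: (@gint_le _ (fun z => 24 * (expR (1 * z) + expR (-1 * z)))).
- exact: measurable_exprn_fun.
- by move=> z; rewrite ger0_norm ?exprn_even_ge0// mul1r mulN1r pow4_le_cosh.
- by apply: gintZ; apply: gintD; exact: gint_expR.
Qed.

Lemma gint_sqr : gint (fun z => z ^+ 2).
Proof.
apply: (@gint_le _ (fun z => 1 + z ^+ 4)).
- exact: measurable_exprn_fun.
- move=> z; rewrite ger0_norm ?sqr_ge0//.
  by rewrite (exprM z 2 2); have := sqr_ge0 z; nra.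
- by apply: gintD; [exact: gint_cst|exact: gint_pow4].
Qed.

(** Exponential moments give t^2 E z^2 <= 2 e^(t^2/2) - 2 <= t^2 e^(t^2/2), and t tends to 0. The
    upper bound is the direction wanted, since 1 - E z^2 will carry a nonnegative factor. *)
Lemma gE_sqr_le1 : gE (fun z => z ^+ 2) <= 1.
Proof.
have h (t : R) : 0 < t -> gE (fun z => z ^+ 2) <= expR (t ^+ 2 / 2).
  move=> t0; rewrite -(ler_pM2l (exprn_gt0 2 t0)) -gEZ; last exact: gint_sqr.
  apply: (@le_trans _ _ (2 * expR (t ^+ 2 / 2) - 2)).
    have -> : 2 * expR (t ^+ 2 / 2) - 2 =
        gE (fun z => expR (t * z) + expR (- t * z) - 2).
      rewrite gEB ?gED ?gE_expR ?gE_cst; try exact: gint_expR; try exact: gint_cst.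
        by rewrite sqrrN; ring.
      by apply: gintD; exact: gint_expR.
    apply: gE_le => [||z].
    - by apply: gintZ; exact: gint_sqr.
    - by apply: gintB; [apply: gintD; exact: gint_expR|exact: gint_cst].
    - by rewrite -exprMn mulNr; exact: sqr_le_cosh.
  set x := t ^+ 2 / 2; have -> : t ^+ 2 = 2 * x by rewrite /x; field.
  have := expR_ge1Dx (- x); rewrite -(ler_pM2r (expR_gt0 x)) -expRD addNr expR0.
  by lra.
apply/ler_addgt0Pr => e e0.
have [t t0 te] : exists2 t : R, 0 < t & expR (t ^+ 2 / 2) <= 1 + e.
  exists (Num.sqrt (2 * ln (1 + e))).
    by rewrite sqrtr_gt0 mulr_gt0// ln_gt0// ltrDl.
  rewrite sqr_sqrtr; last by rewrite mulr_ge0// ln_ge0// lerDl ltW.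
  by rewrite mulrC mulKf// lnK// posrE addr_gt0.
exact: le_trans (h t t0) te.
Qed.

End gaussian_expectation.

(** * The heat semigroup on bounded Lipschitz functions *)

Section heat.
Context {R : realType}.
Implicit Types (u v : R -> R).

Definition bounded_lipschitz (B L : R) v :=
  (forall x, `|v x| <= B) /\ (forall x y, `|v x - v y| <= L * `|x - y|).

Lemma lipschitz_continuous (L : R) v :
  (forall x y, `|v x - v y| <= L * `|x - y|) -> continuous v.
Proof.
move=> vL x; apply/cvgrPdist_le => e e0; near=> y.
apply: le_trans (vL _ _) _; apply: (@le_trans _ _ ((`|L| + 1) * `|x - y|)).
  by rewrite ler_wpM2r// (le_trans (ler_norm L))// lerDl.
rewrite -ler_pdivlMl ?ltr_wpDl//.
near: y; apply: (@cvgr_dist_le _ _ _ _ _ id); first exact: cvg_id.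
by rewrite mulr_gt0// invr_gt0 ltr_wpDl.
Unshelve. all: by end_near. Qed.

Lemma bounded_lipschitz_measurable (B L : R) v : bounded_lipschitz B L v ->
  measurable_fun setT v.
Proof. by move=> [_ /lipschitz_continuous vc]; exact: continuous_measurable_fun. Qed.

Lemma bounded_lipschitz_affine (B L : R) v (x d : R) : bounded_lipschitz B L v ->
  bounded_lipschitz B (L * `|d|) (fun z => v (x + d * z)).
Proof.
move=> [vB vL]; split=> [z|z y]; first exact: vB.
by apply: le_trans (vL _ _) _; rewrite opprD addrACA subrr add0r -mulrBr normrM mulrA.
Qed.

Lemma gint_affine (B L : R) v (x d : R) : bounded_lipschitz B L v ->
  gint (fun z => v (x + d * z)).
Proof.
move=> /(bounded_lipschitz_affine x d) h.
exact: gint_bounded (bounded_lipschitz_measurable h) h.1.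
Qed.

(** The parameter is the standard deviation, not the time; under composition the squares add. *)
Definition heat (d : R) v (x : R) : R := gE (fun z => v (x + d * z)).

Lemma heat_bounded_lipschitz (B L d : R) v : bounded_lipschitz B L v ->
  bounded_lipschitz B L (heat d v).
Proof.
move=> vBL; have [vB vL] := vBL; split=> [x|x y].
  by apply: gE_norm_le => [|z]; [exact: gint_affine vBL|exact: vB].
have ix := gint_affine x d vBL; have iy := gint_affine y d vBL.
rewrite /heat -gEB//; apply: gE_norm_le => [|z]; first exact: gintB.
by have -> : x - y = (x + d * z) - (y + d * z); [ring|exact: vL].
Qed.

Lemma heat_comp (B L a b c x : R) v : bounded_lipschitz B L v -> 0 < b -> 0 < c ->
  a ^+ 2 + b ^+ 2 = c ^+ 2 -> heat a (heat b v) x = heat c v x.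
Proof.
move=> vBL b0 c0 abc; have [vB vL] := vBL.
(* Adding B makes the function nonnegative, as the Tonelli argument requires; it cancels at the
   end. *)
pose h r := v (x + r) + B.
have h0 r : 0 <= h r by rewrite /h -lerBlDr sub0r; have := vB (x + r); rewrite ler_norml => /andP[].
have hL : forall r s, `|h r - h s| <= L * `|r - s|.
  move=> r s; have -> : h r - h s = v (x + r) - v (x + s) by rewrite /h; ring.
  by have -> : r - s = (x + r) - (x + s); [ring|exact: vL].
have ih (d y : R) : gint (fun z => h (y + d * z)).
  by apply: gintD; [under eq_fun do rewrite addrA; exact: gint_affine vBL|exact: gint_cst].
have hE (d y : R) : gE (fun z => h (y + d * z)) = heat d v (x + y) + B.
  rewrite /h gED ?gE_cst; last 2 first.
  - by under eq_fun do rewrite addrA; exact: gint_affine vBL.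
  - exact: gint_cst.
  by rewrite /heat; under eq_fun do rewrite addrA.
have := @integral_normal_pdf_conv R a b c h b0 c0 abc (lipschitz_continuous hL) h0.
under eq_integral do rewrite (gE_fin (ih b _)) hE.
have := ih c 0; under eq_fun do rewrite add0r.
move=> /gE_fin ->; have := hE c 0; under eq_fun do rewrite add0r.
move=> ->; rewrite addr0 gE_fin.
  move=> [/eqP]; rewrite gED ?gE_cst; last 2 first.
  - exact: gint_affine (heat_bounded_lipschitz b vBL).
  - exact: gint_cst.
  by rewrite (inj_eq (addIr B)) => /eqP.
apply: gintD; last exact: gint_cst.
exact: gint_affine (heat_bounded_lipschitz b vBL).
Qed.

End heat.

(** * A single Gaussian step of small size d *)

Section one_step.
Context {R : realType}.
Implicit Types (u p w v : R -> R).

Lemma lerXn2 n (x y : R) : 0 <= x -> x <= y -> x ^+ n <= y ^+ n.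
Proof. by move=> x0 xy; rewrite lerXn2r ?nnegrE ?(le_trans x0). Qed.

(** In terms of q = t / W^2 the Taylor polynomial r satisfies r^2 = 1 + q - q^3 (1 - q / 8) / 8, and
    r is negative when q > 8. *)
Lemma sqrt_lower (W t : R) : 0 < W -> 0 <= t ->
  W + t / (2 * W) - t ^+ 2 / (8 * W ^+ 3) <= Num.sqrt (W ^+ 2 + t).
Proof.
move=> W0 t0; pose q := t / W ^+ 2.
have q0 : 0 <= q by rewrite divr_ge0 ?sqr_ge0.
have -> : t = W ^+ 2 * q by rewrite /q mulrC divfK// gt_eqF// exprn_gt0.
have -> : W + W ^+ 2 * q / (2 * W) - (W ^+ 2 * q) ^+ 2 / (8 * W ^+ 3) =
  W * (1 + q / 2 - q ^+ 2 / 8) by field; rewrite gt_eqF.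
have -> : W ^+ 2 + W ^+ 2 * q = W ^+ 2 * (1 + q) by ring.
rewrite sqrtrM ?sqr_ge0// sqrtr_sqr gtr0_norm// ler_pM2l//.
set r := 1 + _ - _; have [r0|/ltW r0] := leP 0 r; last by apply: le_trans r0 _.
rewrite -(ger0_norm r0) -sqrtr_sqr ler_wsqrtr//.
have q8 : q <= 8.
  rewrite leNgt; apply/negP => q8; move: r0; apply/negP; rewrite -ltNge /r.
  by nra.
have -> : r ^+ 2 = 1 + q - q ^+ 3 / 8 * (1 - q / 8) by rewrite /r; field.
rewrite lerBlDr lerDl mulr_ge0 ?divr_ge0 ?exprn_ge0//.
by rewrite subr_ge0 ler_pdivrMr// mul1r.
Qed.

Lemma pow4_norm (z : R) : z ^+ 4 = `|z| ^+ 4.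
Proof. by rewrite -normrX ger0_norm// exprn_even_ge0. Qed.

(** The function 1 + z^4 is the common integrable majorant for all errors of a step. *)
Lemma norm_le_pow4 (z : R) : `|z| <= 1 + z ^+ 4.
Proof.
rewrite pow4_norm; have t0 := normr_ge0 z; set t := `|z|.
have [t1|/ltW t1] := leP t 1; first by rewrite (le_trans t1)// lerDl exprn_ge0.
by rewrite ler_wpDl// ler_eXnr.
Qed.

(** W and P are values at x + d z, p0 is the value at x and b0 the average of W. The three constants
    pay for replacing P^2 by p0^2, for replacing W by b0 in the denominator, and for the last term
    of [sqrt_lower]. *)
Lemma step_sqrt (L be W P p0 b0 d z : R) : 0 < be -> be <= W -> be <= b0 ->
  `|P| <= L -> `|p0| <= L -> `|P - p0| <= L * (d * `|z|) ->
  `|W - b0| <= L * (d * (`|z| + 1)) -> 0 < d -> d <= 1 ->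
  W + (d * p0) ^+ 2 / (2 * b0) -
    (L ^+ 2 / be + L ^+ 3 / be ^+ 2 + L ^+ 4 / be ^+ 3) * d ^+ 3 * (1 + z ^+ 4)
  <= Num.sqrt (W ^+ 2 + (d * P) ^+ 2).
Proof.
move=> be0 beW beb PL pL Pp Wb d0 d1.
have W0 := lt_le_trans be0 beW; have b00 := lt_le_trans be0 beb.
have L0 : 0 <= L by exact: le_trans PL.
have z4 := norm_le_pow4 z; have z40 : 0 <= z ^+ 4 by rewrite exprn_even_ge0.
apply: le_trans (sqrt_lower W0 (sqr_ge0 (d * P))).
have P4 : P ^+ 4 <= L ^+ 4 by rewrite pow4_norm lerXn2.
have h1 : (d * P) ^+ 2 ^+ 2 / (8 * W ^+ 3) <= L ^+ 4 / be ^+ 3 * d ^+ 3 * (1 + z ^+ 4).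
  rewrite -[(_ ^+ 2) ^+ 2]exprM (_ : (2 * 2)%N = 4%N)// exprMn.
  apply: (@le_trans _ _ (d ^+ 3 * L ^+ 4 / (8 * W ^+ 3))).
    rewrite ler_pM2r ?invr_gt0 ?mulr_gt0 ?exprn_gt0//.
    apply: ler_pM; rewrite ?exprn_even_ge0//.
    by rewrite exprS ler_piMl// exprn_ge0// ltW.
  have -> : L ^+ 4 / be ^+ 3 * d ^+ 3 * (1 + z ^+ 4) =
      d ^+ 3 * L ^+ 4 * ((be ^+ 3)^-1 * (1 + z ^+ 4)) by ring.
  rewrite ler_wpM2l ?mulr_ge0 ?exprn_ge0 ?(ltW d0)//.
  apply: (@le_trans _ _ (be ^+ 3)^-1); last first.
    by rewrite ler_peMr ?invr_ge0 ?exprn_ge0 ?(ltW be0)// lerDl.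
  rewrite lef_pV2 ?posrE ?mulr_gt0 ?exprn_gt0//.
  apply: (@le_trans _ _ (W ^+ 3)).
    by apply: lerXn2 => //; exact: ltW.
  by rewrite ler_peMl ?exprn_ge0 ?(ltW W0)// ler1n.
have h2 : `|(P ^+ 2 - p0 ^+ 2) / (2 * W)| <= L ^+ 2 / be * d * (1 + z ^+ 4).
  rewrite subr_sqr normrM normfV [`|2 * W|]gtr0_norm ?mulr_gt0// normrM.
  apply: (@le_trans _ _ (L * (d * `|z|) * (L + L) / (2 * be))).
    apply: ler_pM; rewrite ?mulr_ge0 ?invr_ge0 ?mulr_ge0 ?(ltW W0)//.
      by apply: ler_pM => //; apply: le_trans (ler_normD _ _) _; apply: lerD.
    by rewrite lef_pV2 ?posrE ?mulr_gt0// ler_pM2l.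
  have -> : L * (d * `|z|) * (L + L) / (2 * be) = L ^+ 2 / be * d * `|z|.
    by field; rewrite gt_eqF.
  by rewrite ler_wpM2l// !mulr_ge0 ?invr_ge0 ?sqr_ge0// ltW.
have h3 : `|p0 ^+ 2 * (b0 - W) / (2 * W * b0)| <= L ^+ 3 / be ^+ 2 * d * (1 + z ^+ 4).
  rewrite normrM normfV (normrM (p0 ^+ 2)) normrX distrC.
  rewrite [`|2 * W * b0|]gtr0_norm ?mulr_gt0//.
  apply: (@le_trans _ _ (L ^+ 2 * (L * (d * (`|z| + 1))) / (2 * be * be))).
    apply: ler_pM; rewrite ?mulr_ge0 ?invr_ge0 ?mulr_ge0 ?exprn_ge0 ?(ltW W0) ?(ltW b00)//.
      by apply: ler_pM; rewrite ?exprn_ge0// lerXn2.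
    rewrite lef_pV2 ?posrE ?mulr_gt0//.
    by apply: ler_pM; rewrite ?mulr_ge0 ?(ltW be0)// ler_pM2l.
  have -> : L ^+ 2 * (L * (d * (`|z| + 1))) / (2 * be * be) =
      L ^+ 3 / be ^+ 2 * d * ((`|z| + 1) / 2) by field; rewrite gt_eqF.
  rewrite ler_wpM2l ?mulr_ge0 ?invr_ge0 ?exprn_ge0 ?(ltW be0) ?(ltW d0)//.
  by lra.
have h4 : (d * P) ^+ 2 / (2 * W) - (d * p0) ^+ 2 / (2 * b0) =
    d ^+ 2 * ((P ^+ 2 - p0 ^+ 2) / (2 * W) + p0 ^+ 2 * (b0 - W) / (2 * W * b0)).
  by field; rewrite !gt_eqF.
have {}h2 : - (L ^+ 2 / be * d * (1 + z ^+ 4)) <= (P ^+ 2 - p0 ^+ 2) / (2 * W).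
  by move: h2; rewrite ler_norml => /andP[].
have {}h3 : - (L ^+ 3 / be ^+ 2 * d * (1 + z ^+ 4)) <= p0 ^+ 2 * (b0 - W) / (2 * W * b0).
  by move: h3; rewrite ler_norml => /andP[].
have := ler_wpM2l (sqr_ge0 d) (lerD h2 h3); rewrite -h4.
rewrite (_ : d ^+ 2 * _ = - ((L ^+ 2 / be + L ^+ 3 / be ^+ 2) * d ^+ 3 * (1 + z ^+ 4))).
  by move: h1; rewrite !mulrDl; lra.
by ring.
Qed.

(** The expansion is made around ux = u(x), whereas a0 is the mean of a. The correction linear in a
    - a0 is kept exactly, for its mean is zero; the leftover square of a0 - ux has a favourable
    sign. *)
Lemma step_sqr (L a ux a0 p0 d z : R) : `|p0| <= L -> 0 < d -> d <= 1 ->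
  `|a - ux - d * z * p0| <= L * (d * z) ^+ 2 ->
  (a - a0) ^+ 2 <= (d * p0) ^+ 2 * z ^+ 2 + 3 * L ^+ 2 * d ^+ 3 * (1 + z ^+ 4)
    - 2 * (a0 - ux) * (a - a0).
Proof.
move=> pL d0 d1; have L0 : 0 <= L by exact: le_trans pL.
set ep := a - ux - d * z * p0 => hep.
have -> : (a - a0) ^+ 2 = (d * p0) ^+ 2 * z ^+ 2 + 2 * (d * z * p0 * ep) + ep ^+ 2
    - 2 * (a0 - ux) * (a - a0) - (a0 - ux) ^+ 2 by rewrite /ep; ring.
have Ld : 0 <= L ^+ 2 * d ^+ 3.
  by apply: mulr_ge0; [exact: sqr_ge0|exact/exprn_ge0/ltW].
have h1 : d * z * p0 * ep <= L ^+ 2 * d ^+ 3 * `|z| ^+ 3.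
  apply: le_trans (ler_norm _) _; rewrite !normrM (gtr0_norm d0).
  have -> : L ^+ 2 * d ^+ 3 * `|z| ^+ 3 = d * `|z| * L * (L * (d * `|z|) ^+ 2) by ring.
  apply: ler_pM; rewrite ?mulr_ge0 ?(ltW d0)//.
    by rewrite ler_wpM2l// mulr_ge0// ltW.
  by apply: le_trans hep _; rewrite !exprMn real_normK ?num_real.
have h2 : ep ^+ 2 <= L ^+ 2 * d ^+ 3 * z ^+ 4.
  rewrite -(real_normK (num_real ep)).
  apply: (@le_trans _ _ ((L * (d * z) ^+ 2) ^+ 2)).
    by rewrite lerXn2.
  have -> : (L * (d * z) ^+ 2) ^+ 2 = L ^+ 2 * d ^+ 3 * z ^+ 4 * d by ring.
  by rewrite ler_piMr// mulr_ge0// exprn_even_ge0.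
have h3 : 2 * `|z| ^+ 3 <= 1 + 2 * z ^+ 4.
  rewrite pow4_norm; have t0 := normr_ge0 z; set t := `|z|.
  have h : 0 <= (t ^+ 2 - t) ^+ 2 + (t ^+ 2 - 1) ^+ 2 by rewrite addr_ge0 ?sqr_ge0.
  have -> : t ^+ 4 = (t ^+ 2) ^+ 2 by rewrite -exprM.
  have e : t ^+ 3 = t ^+ 2 * t by rewrite exprSr.
  by move: h; rewrite e; set s := t ^+ 2; rewrite /s; nra.
have := sqr_ge0 (a0 - ux); have := ler_wpM2l Ld h3.
have z40 : 0 <= z ^+ 4 by rewrite exprn_even_ge0.
move: h1 h2; have := mulr_ge0 Ld z40; rewrite -(mulrA 3) -(mulrA 3).
move: (L ^+ 2 * d ^+ 3) Ld => Q Q0.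
move: (z ^+ 4) (`|z| ^+ 3) (d * z * p0 * ep) (ep ^+ 2) ((a0 - ux) ^+ 2) => z4 z3 x1 x2 x3.
move: ((d * p0) ^+ 2 * z ^+ 2) (2 * (a0 - ux) * (a - a0)) => x4 x5.
rewrite !mulrDr !mulr1 (mulrCA Q 2 z3) (mulrCA Q 2 z4).
move: (Q * z3) (Q * z4) => y3 y4; lra.
Qed.

(** Algebra, for q = (d p0)^2, T = d^3 (1 + z^4), z2 = z^2 and c3 = |A - A0|^3. The gain q / (2 b0)
    meets the cost q z2 / (2 b0), which leaves the factor 1 - z2. *)
Lemma step_combine (M y W b0 be s0 A A0 ux q T C1 C2 L c3 ic z2 : R) :
  0 < be -> be <= b0 -> 0 < ic -> ic <= C1 -> 0 <= T -> 0 <= C2 ->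
  W + q / (2 * b0) - C2 * T <= y ->
  (A - A0) ^+ 2 <= q * z2 + 3 * L ^+ 2 * T - 2 * (A0 - ux) * (A - A0) ->
  c3 <= 8 * L ^+ 3 * T ->
  M + (ic * (W - b0) + (ic * (- s0 + (A0 - ux) / b0) * (A - A0) +
    (ic * q / (2 * b0) * (1 - z2) -
     (C1 * (C2 + 3 * L ^+ 2 / (2 * be)) + C1 * (8 * L ^+ 3)) * T))) <=
  M + ic * (y - b0 - s0 * (A - A0) - (A - A0) ^+ 2 / (2 * b0)) - C1 * c3.
Proof.
move=> be0 beb ic0 icC T0 C20 hy hA hc.
have b00 := lt_le_trans be0 beb; have C10 : 0 <= C1 by rewrite (le_trans (ltW ic0)).
have h1 := ler_wpM2l C10 hc.
have i2b : 0 < (2 * b0)^-1 by rewrite invr_gt0 mulr_gt0.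
have h2 := ler_wpM2r (ltW i2b) hA.
have h3 : 3 * L ^+ 2 * T / (2 * b0) <= 3 * L ^+ 2 / (2 * be) * T.
  rewrite mulrAC ler_wpM2r// ler_wpM2l//.
    by apply: mulr_ge0 => //; exact: sqr_ge0.
  by rewrite lef_pV2 ?posrE ?mulr_gt0// ler_pM2l.
have h4 : ic * (W + q / (2 * b0) - C2 * T - b0 - s0 * (A - A0) -
   (q * z2 / (2 * b0) + 3 * L ^+ 2 / (2 * be) * T - (A0 - ux) * (A - A0) / b0))
   <= ic * (y - b0 - s0 * (A - A0) - (A - A0) ^+ 2 / (2 * b0)).
  rewrite ler_pM2l//.
  have e : (q * z2 + 3 * L ^+ 2 * T - 2 * (A0 - ux) * (A - A0)) / (2 * b0) =
    q * z2 / (2 * b0) + 3 * L ^+ 2 * T / (2 * b0) - (A0 - ux) * (A - A0) / b0.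
    by field; rewrite gt_eqF.
  rewrite e in h2.
  move: hy h2 h3; move: (_ / (2 * be) * T) (_ * T / (2 * b0)) => x1 x2.
  move: (q / (2 * b0)) (C2 * T) (_ / (2 * b0)) (_ / b0) => x3 x4 x5 x6.
  by move: ((A - A0) ^+ 2 / _) (s0 * _) => x7 x8; lra.
have h5 : ic * (C2 * T + 3 * L ^+ 2 / (2 * be) * T) <=
    C1 * (C2 * T + 3 * L ^+ 2 / (2 * be) * T).
  rewrite ler_wpM2r//; apply: addr_ge0; first exact: mulr_ge0.
  apply: mulr_ge0 => //; apply: divr_ge0; last by rewrite mulr_ge0// ltW.
  by apply: mulr_ge0 => //; exact: sqr_ge0.
move: h1 h4 h5; set X := ic * (y - _ - _ - _).
have -> : ic * (W + q / (2 * b0) - C2 * T - b0 - s0 * (A - A0) -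
   (q * z2 / (2 * b0) + 3 * L ^+ 2 / (2 * be) * T - (A0 - ux) * (A - A0) / b0)) =
  (ic * (W - b0) + (ic * (- s0 + (A0 - ux) / b0) * (A - A0) +
    ic * q / (2 * b0) * (1 - z2))) - ic * (C2 * T + 3 * L ^+ 2 / (2 * be) * T).
  by field; rewrite !gt_eqF.
have -> : (C1 * (C2 + 3 * L ^+ 2 / (2 * be)) + C1 * (8 * L ^+ 3)) * T =
   C1 * (C2 * T + 3 * L ^+ 2 / (2 * be) * T) + C1 * (8 * L ^+ 3 * T) by ring.
lra.
Qed.

Lemma cube_le_pow4 (z : R) : (`|z| + 1) ^+ 3 <= 8 * (1 + z ^+ 4).
Proof.
rewrite pow4_norm; have t0 := normr_ge0 z; set t := `|z|.
have [t1|t1] := leP t 1.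
  apply: (@le_trans _ _ (2 ^+ 3)).
    by rewrite lerXn2 ?addr_ge0//; rewrite -[2]/(1 + 1) lerD2r.
  have : 0 <= t ^+ 4 by rewrite exprn_ge0.
  by rewrite -natrX (_ : (2 ^ 3)%N = 8%N)//; lra.
apply: (@le_trans _ _ ((2 * t) ^+ 3)).
  by rewrite lerXn2 ?addr_ge0//; lra.
have : t ^+ 3 <= t ^+ 4 by rewrite ler_weXn2l// ltW.
by rewrite exprMn -natrX (_ : (2 ^ 3)%N = 8%N)//; lra.
Qed.

(** That p is the derivative of u is expressed by a quadratic Taylor remainder; in this form every
    clause passes to Gaussian averages with the same constants. *)
Definition one_step_spec (m L be : R) u p w :=
  [/\ forall x, m <= u x <= L, forall x y, `|u x - u y| <= L * `|x - y|,
      forall x h, `|u (x + h) - u x - h * p x| <= L * h ^+ 2,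
      bounded_lipschitz L L p &
      (forall x, be <= w x <= L) /\ (forall x y, `|w x - w y| <= L * `|x - y|)].

Lemma gint_norm_id : gint (fun z : R => `|z|).
Proof.
apply: (@gint_le _ _ (fun z => 1 + z ^+ 4)).
- exact: measurableT_comp.
- by move=> z; rewrite normr_id norm_le_pow4.
- by apply: gintD; [exact: gint_cst|exact: gint_pow4].
Qed.

Lemma gE_norm_id_le1 : gE (fun z : R => `|z|) <= 1.
Proof.
have i := gintZ 2^-1 (gintD (gint_cst 1) (@gint_sqr R)).
apply: (@le_trans _ _ (gE (fun z : R => 2^-1 * (1 + z ^+ 2)))).
  apply: gE_le gint_norm_id i _ => z; rewrite -(real_normK (num_real z)).
  by have := sqr_ge0 (`|z| - 1); rewrite sqrrB expr1n mulr1; lra.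
rewrite gEZ; last exact: gintD (gint_cst 1) (@gint_sqr R).
rewrite gED ?gE_cst; [|exact: gint_cst|exact: gint_sqr].
by have := @gE_sqr_le1 R; lra.
Qed.

(** Compare with v(x + d y), average over y and use E |y| <= 1. *)
Lemma heat_dist (B L d x z : R) v : 0 <= L -> 0 <= d -> bounded_lipschitz B L v ->
  `|v (x + d * z) - heat d v x| <= L * (d * (`|z| + 1)).
Proof.
move=> L0 d0 vBL; have iv := gint_affine x d vBL.
rewrite -[v (x + d * z)]gE_cst /heat -gEB//; last exact: gint_cst.
have i1 := gintB (gint_cst (v (x + d * z))) iv.
apply: le_trans (gE_norm i1) _.
have i2 := gintZ (L * d) (gintD (gint_cst `|z|) gint_norm_id).
apply: (@le_trans _ _ (gE (fun y : R => L * d * (`|z| + `|y|)))).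
  apply: gE_le (gint_norm i1) i2 _ => y; apply: le_trans (vBL.2 _ _) _.
  rewrite opprD addrACA subrr add0r -mulrBr normrM ger0_norm// -mulrA.
  by rewrite !ler_wpM2l// (le_trans (ler_normB _ _)).
rewrite gEZ; last exact: gintD (gint_cst _) gint_norm_id.
rewrite gED ?gE_cst; [|exact: gint_cst|exact: gint_norm_id].
by rewrite -mulrA !ler_wpM2l// lerD2l gE_norm_id_le1.
Qed.

(** C is chosen before the functions and d, so it can be reused at each of the N steps. *)
Lemma Mfun_one_step (m L be : R) : 0 < m -> m <= L -> 0 < be -> be <= L ->
  exists2 C : R, 0 < C & forall u p w v (B L' d : R),
  one_step_spec m L be u p w -> bounded_lipschitz B L' v -> 0 < d -> d <= 1 ->
  (forall x, Mfun (u x) (Num.sqrt (w x ^+ 2 + (d * p x) ^+ 2)) <= v x) ->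
  forall x, Mfun (heat d u x) (heat d w x) - C * d ^+ 3 <= heat d v x.
Proof.
move=> m0 mL be0 beL; have L0 := lt_le_trans m0 mL.
have [C1 C10 HC1] := Mfun_support m0 mL be0 beL.
pose C2 := L ^+ 2 / be + L ^+ 3 / be ^+ 2 + L ^+ 4 / be ^+ 3.
have C20 : 0 < C2 by rewrite !addr_gt0 ?divr_gt0 ?exprn_gt0.
pose C3 := C1 * (C2 + 3 * L ^+ 2 / (2 * be)) + C1 * (8 * L ^+ 3).
have C30 : 0 < C3.
  by rewrite addr_gt0 ?mulr_gt0 ?addr_gt0 ?divr_gt0 ?mulr_gt0 ?exprn_gt0.
pose E4 := gE (fun z : R => 1 + z ^+ 4).
have E40 : 0 <= E4 by apply: gE_ge0 => z; rewrite addr_ge0// exprn_even_ge0.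
exists (C3 * (1 + E4)); first by rewrite mulr_gt0// ltr_pwDl.
move=> u p w v B L' d [uB uL uT pBL [wB wL]] vBL d0 d1 Mv x.
have uBL : bounded_lipschitz L L u.
  split=> // y; have /andP[h1 h2] := uB y.
  by rewrite ger0_norm// (le_trans (ltW m0)).
have wBL : bounded_lipschitz L L w.
  split=> // y; have /andP[h1 h2] := wB y.
  by rewrite ger0_norm// (le_trans (ltW be0)).
have iu := gint_affine x d uBL; have iw := gint_affine x d wBL.
have iv := gint_affine x d vBL.
set a0 := heat d u x; set b0 := heat d w x.
have a0B : m <= a0 <= L by apply: gE_bounded.
have b0B : be <= b0 <= L by apply: gE_bounded.
have [s0 [ic [/andP[ic0 icC] HM]]] := HC1 a0 b0 a0B b0B.
have b0be : be <= b0 by case/andP: b0B.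
have b00 : 0 < b0 by exact: lt_le_trans b0be.
pose ka := ic * (- s0 + (a0 - u x) / b0).
pose e := ic * (d * p x) ^+ 2 / (2 * b0).
have e0 : 0 <= e.
  by rewrite divr_ge0//; apply: mulr_ge0; rewrite ?sqr_ge0 ?(ltW ic0) ?(ltW b00).
(* A minorant of v along z. The terms with [ic] and [ka] have mean zero, [ka] including the linear
   correction from [step_sqr]; the term with [e] has nonnegative mean, and the last one is the
   loss. *)
pose G z := Mfun a0 b0 + (ic * (w (x + d * z) - b0) + (ka * (u (x + d * z) - a0) +
   (e * (1 - z ^+ 2) - C3 * d ^+ 3 * (1 + z ^+ 4)))).
have vG z : G z <= v (x + d * z).
  apply: le_trans (Mv _).
  apply: le_trans (HM _ _ (uB (x + d * z)) (sqrtr_ge0 _)).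
  set a := u (x + d * z).
  have ha : `|a - a0| <= L * (d * (`|z| + 1)).
    by apply: heat_dist uBL; exact: ltW.
  have hw : `|w (x + d * z) - b0| <= L * (d * (`|z| + 1)).
    by apply: heat_dist wBL; exact: ltW.
  have T0 : 0 <= d ^+ 3 * (1 + z ^+ 4).
    by rewrite mulr_ge0 ?exprn_ge0 ?(ltW d0)// addr_ge0// exprn_even_ge0.
  rewrite /G /e /ka -[C3 * _ * _]mulrA; apply: step_combine => //.
  - exact: ltW.
  - rewrite mulrA; apply: step_sqrt => //; [|exact: pBL.1|exact: pBL.1|].
      by case/andP: (wB (x + d * z)).
    apply: le_trans (pBL.2 _ _) _.
    by rewrite addrAC subrr add0r normrM (gtr0_norm d0).
  - by rewrite mulrA; apply: step_sqr => //; exact: pBL.1.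
  - apply: (@le_trans _ _ ((L * (d * (`|z| + 1))) ^+ 3)).
      by rewrite lerXn2.
    have -> : (L * (d * (`|z| + 1))) ^+ 3 = (L ^+ 3 * d ^+ 3) * (`|z| + 1) ^+ 3 by ring.
    have -> : 8 * L ^+ 3 * (d ^+ 3 * (1 + z ^+ 4)) = (L ^+ 3 * d ^+ 3) * (8 * (1 + z ^+ 4)).
      by ring.
    by rewrite ler_wpM2l ?mulr_ge0 ?exprn_ge0 ?(ltW d0) ?(ltW L0)// cube_le_pow4.
have iG1 : gint (fun z => ic * (w (x + d * z) - b0)).
  by apply: gintZ; apply: gintB => //; exact: gint_cst.
have iG2 : gint (fun z => ka * (u (x + d * z) - a0)).
  by apply: gintZ; apply: gintB => //; exact: gint_cst.
have i14 : gint (fun z : R => 1 + z ^+ 4).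
  by apply: gintD; [exact: gint_cst|exact: gint_pow4].
have i12 : gint (fun z : R => 1 - z ^+ 2).
  by apply: gintB; [exact: gint_cst|exact: gint_sqr].
have iG3 := gintZ e i12; have iG4 := gintZ (C3 * d ^+ 3) i14.
have iG34 := gintB iG3 iG4; have iG234 := gintD iG2 iG34.
have iG1234 := gintD iG1 iG234.
have iG : gint G by apply: gintD iG1234; exact: gint_cst.
apply: le_trans (gE_le iG iv vG).
have E1 : gE (fun z => ic * (w (x + d * z) - b0)) = 0.
  rewrite gEZ; last exact: gintB iw (gint_cst b0).
  by rewrite (gEB iw (gint_cst b0)) gE_cst subrr mulr0.
have E2 : gE (fun z => ka * (u (x + d * z) - a0)) = 0.
  rewrite gEZ; last exact: gintB iu (gint_cst a0).
  by rewrite (gEB iu (gint_cst a0)) gE_cst subrr mulr0.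
rewrite /G (gED (gint_cst _) iG1234) gE_cst lerD2l (gED iG1 iG234) (gED iG2 iG34).
rewrite E1 E2 !add0r (gEB iG3 iG4) (gEZ _ i12) (gEZ _ i14) -/E4.
rewrite (gEB (gint_cst 1) (@gint_sqr R)) gE_cst.
have : 0 <= e * (1 - gE (fun z : R => z ^+ 2)).
  by rewrite mulr_ge0// subr_ge0 gE_sqr_le1.
have : 0 <= C3 * d ^+ 3 by apply: mulr_ge0; [exact: ltW|exact/exprn_ge0/ltW].
have -> : C3 * (1 + E4) * d ^+ 3 = C3 * d ^+ 3 + C3 * d ^+ 3 * E4 by ring.
by move: (C3 * d ^+ 3) (e * _) (_ * E4) => y1 y2 y3; lra.
Qed.

End one_step.

(** * Euclidean norms with one extra constant coordinate *)

Section euclidean.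
Context {R : realType} {I : finType}.
Implicit Types (c : R) (x y : I -> R).

(** For c >= 0, the norm of x enlarged by a coordinate sqrt c. *)
Definition rnorm c x : R := Num.sqrt (c + \sum_i x i ^+ 2).

Lemma rnorm_arg_ge0 c x : 0 <= c -> 0 <= c + \sum_i x i ^+ 2.
Proof. by move=> c0; rewrite addr_ge0// sumr_ge0// => i _; exact: sqr_ge0. Qed.

Lemma rnorm_ge0 c x : 0 <= rnorm c x. Proof. exact: sqrtr_ge0. Qed.

Lemma sqr_rnorm c x : 0 <= c -> rnorm c x ^+ 2 = c + \sum_i x i ^+ 2.
Proof. by move=> c0; rewrite sqr_sqrtr// rnorm_arg_ge0. Qed.

Lemma sqrt_le_rnorm c x : Num.sqrt c <= rnorm c x.
Proof. by apply: ler_wsqrtr; rewrite lerDl sumr_ge0// => i _; exact: sqr_ge0. Qed.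

Lemma coord_le_rnorm c x i : 0 <= c -> `|x i| <= rnorm c x.
Proof.
move=> c0; rewrite -sqrtr_sqr ler_wsqrtr// (bigD1 i)//= addrCA lerDl.
by rewrite addr_ge0// sumr_ge0// => j _; exact: sqr_ge0.
Qed.

(** Cauchy-Schwarz for the enlarged vectors: la times the first is the projection of the second, and
    the remainder has nonnegative squared length. *)
Lemma rnorm_cauchy c x y : 0 <= c -> 0 < rnorm c x ->
  c + \sum_i x i * y i <= rnorm c x * rnorm c y.
Proof.
move=> c0 S0; set X := c + _.
have [X0|/ltW X0] := leP 0 X; last by rewrite (le_trans X0)// mulr_ge0 ?rnorm_ge0.
have S20 : 0 < rnorm c x ^+ 2 by rewrite exprn_gt0.
pose la := X / rnorm c x ^+ 2.
have h : 0 <= c * (1 - la) ^+ 2 + \sum_i (y i - la * x i) ^+ 2.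
  apply: addr_ge0; first by apply: mulr_ge0 => //; exact: sqr_ge0.
  by apply: sumr_ge0 => i _; exact: sqr_ge0.
have e : c * (1 - la) ^+ 2 + \sum_i (y i - la * x i) ^+ 2 =
   rnorm c y ^+ 2 - 2 * la * X + la ^+ 2 * rnorm c x ^+ 2.
  rewrite !sqr_rnorm// /X.
  have -> : \sum_i (y i - la * x i) ^+ 2 = \sum_i y i ^+ 2 -
      2 * la * (\sum_i x i * y i) + la ^+ 2 * (\sum_i x i ^+ 2).
    rewrite !mulr_sumr -sumrB -big_split/=; apply: eq_bigr => i _; ring.
  by ring.
rewrite -(ger0_norm X0) -sqrtr_sqr -(ger0_norm (rnorm_ge0 c x)) -[`|rnorm c x|]sqrtr_sqr.
rewrite -(ger0_norm (rnorm_ge0 c y)) -[`|rnorm c y|]sqrtr_sqr -sqrtrM ?sqr_ge0// ler_wsqrtr//.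
rewrite e in h; have eX : X = la * rnorm c x ^+ 2 by rewrite /la divfK ?gt_eqF.
have : 0 <= (rnorm c y ^+ 2 - 2 * la * X + la ^+ 2 * rnorm c x ^+ 2) * rnorm c x ^+ 2.
  by rewrite mulr_ge0// ltW.
set S := rnorm c x ^+ 2; set T := rnorm c y ^+ 2.
have -> : (T - 2 * la * X + la ^+ 2 * S) * S = S * T - X ^+ 2.
  transitivity (T * S - 2 * (la * S) * X + (la * S) ^+ 2); first ring.
  by rewrite -eX; ring.
by rewrite subr_ge0.
Qed.

Lemma rnorm_le_sum c x y : 0 <= c -> rnorm c x <= rnorm c y + \sum_i `|x i - y i|.
Proof.
move=> c0; have D0 : 0 <= \sum_i `|x i - y i| by exact: sumr_ge0.
have h0 : 0 <= rnorm c y + \sum_i `|x i - y i| by rewrite addr_ge0 ?rnorm_ge0.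
rewrite -(ger0_norm h0) -sqrtr_sqr ler_wsqrtr//.
rewrite sqrrD sqr_rnorm// -addrA -addrA lerD2l.
have -> : \sum_i x i ^+ 2 = \sum_i y i ^+ 2 +
    (\sum_i 2 * y i * (x i - y i) + \sum_i (x i - y i) ^+ 2).
  by rewrite -!big_split/=; apply: eq_bigr => i _; ring.
rewrite lerD2l; apply: lerD.
  rewrite -mulrnAl mulr_sumr; apply: ler_sum => i _.
  apply: le_trans (ler_norm _) _; rewrite normrM ler_wpM2r//.
  by rewrite normrM ger0_norm// -[leRHS]mulr_natl ler_wpM2l// coord_le_rnorm.
apply: (@le_trans _ _ (\sum_i `|x i - y i| * \sum_j `|x j - y j|)); last first.
  by rewrite -mulr_suml expr2.
apply: ler_sum => i _; rewrite -(real_normK (num_real (x i - y i))) expr2.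
by rewrite ler_wpM2l// (bigD1 i)//= lerDl sumr_ge0.
Qed.

Lemma rnorm_dist c x y : 0 <= c -> `|rnorm c x - rnorm c y| <= \sum_i `|x i - y i|.
Proof.
move=> c0; rewrite ler_norml; apply/andP; split.
  rewrite lerNl opprB lerBlDl (le_trans (rnorm_le_sum y x c0))// lerD2l.
  by apply: ler_sum => i _; rewrite distrC.
by rewrite lerBlDl rnorm_le_sum.
Qed.

(** Minkowski's inequality by duality: if S is the norm of the vector of means, S^2 is the mean of
    the inner product of that vector with q, at most S times the mean of the norm of q. *)
Lemma rnorm_gE c (q : I -> R -> R) : 0 <= c -> (forall i, gint (q i)) ->
  gint (fun z => rnorm c (q^~ z)) ->
  rnorm c (fun i => gE (q i)) <= gE (fun z => rnorm c (q^~ z)).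
Proof.
move=> c0 iq ir; set S := rnorm c _.
have [S0|] := leP S 0; first by apply: le_trans S0 _; apply: gE_ge0 => z; exact: rnorm_ge0.
move=> S0; rewrite -(ler_pM2l S0) -expr2 sqr_rnorm// -gEZ//.
have is_ (r : seq I) : gint (fun z => \sum_(i <- r) gE (q i) * q i z) /\
   gE (fun z => \sum_(i <- r) gE (q i) * q i z) = \sum_(i <- r) gE (q i) ^+ 2.
  elim: r => [|i r [IH1 IH2]].
    by under eq_fun do rewrite big_nil; rewrite big_nil; split; [exact: gint_cst|exact: gE_cst].
  under eq_fun do rewrite big_cons.
  have i1 := gintZ (gE (q i)) (iq i).
  split; first exact: gintD.
  by rewrite big_cons gED// IH2 gEZ.
have [i1 e1] := is_ (index_enum I).
rewrite -e1 -[c in c + _]gE_cst -gED//; last exact: gint_cst.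
apply: gE_le.
- by apply: gintD => //; exact: gint_cst.
- exact: gintZ.
- by move=> z; apply: rnorm_cauchy.
Qed.

End euclidean.

(** * The one-dimensional inequality, by N small steps *)

Section gauss_dim1.
Context {R : realType}.
Implicit Types (u p b v : R -> R).

Lemma bounded_lipschitz_le (B L B' L' : R) v : B <= B' -> L <= L' ->
  bounded_lipschitz B L v -> bounded_lipschitz B' L' v.
Proof.
move=> BB LL [vB vL]; split=> [x|x y]; first exact: le_trans (vB x) BB.
by apply: le_trans (vL x y) _; rewrite ler_wpM2r.
Qed.

Lemma heat0 v : heat 0 v = v.
Proof.
by apply/funext => x; rewrite /heat; under eq_fun do rewrite mul0r addr0; rewrite gE_cst.
Qed.

Lemma gE_affine_bounds (B L d x lo hi : R) v : bounded_lipschitz B L v ->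
  (forall y, lo <= v y <= hi) -> lo <= heat d v x <= hi.
Proof. by move=> vBL vlh; apply: gE_bounded => //; exact: gint_affine vBL. Qed.

Lemma bounded_lipschitz_of_bounds (lo hi L : R) v : 0 <= lo ->
  (forall x, lo <= v x <= hi) -> (forall x y, `|v x - v y| <= L * `|x - y|) ->
  bounded_lipschitz hi L v.
Proof.
move=> lo0 vlh vL; split=> // x; have /andP[h1 h2] := vlh x.
by rewrite ger0_norm// (le_trans lo0).
Qed.

Lemma heat_taylor (B L L1 d : R) u p : bounded_lipschitz B L u -> bounded_lipschitz B L p ->
  (forall x h, `|u (x + h) - u x - h * p x| <= L1 * h ^+ 2) ->
  forall x h, `|heat d u (x + h) - heat d u x - h * heat d p x| <= L1 * h ^+ 2.
Proof.
move=> uBL pBL uT x h.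
have i1 := gint_affine (x + h) d uBL; have i2 := gint_affine x d uBL.
have i3 := gintZ h (gint_affine x d pBL).
rewrite /heat -gEZ; last exact: gint_affine pBL.
rewrite -(gEB i1 i2) -(gEB (gintB i1 i2) i3).
apply: gE_norm_le; first exact: gintB (gintB i1 i2) i3.
by move=> z; rewrite (addrAC x); exact: uT.
Qed.

Lemma one_step_spec_heat (m L be d : R) u p b : 0 <= m -> 0 <= be ->
  one_step_spec m L be u p b ->
  one_step_spec m L be (heat d u) (heat d p) (heat d b).
Proof.
move=> m0 be0 [uB uL uT pBL [bB bL]].
have uBL := bounded_lipschitz_of_bounds m0 uB uL.
have bBL := bounded_lipschitz_of_bounds be0 bB bL.
split.
- by move=> x; exact: gE_affine_bounds uBL uB.
- exact: (heat_bounded_lipschitz d uBL).2.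
- exact: heat_taylor uBL pBL uT.
- exact: heat_bounded_lipschitz.
- split; first by move=> x; exact: gE_affine_bounds bBL bB.
  exact: (heat_bounded_lipschitz d bBL).2.
Qed.

(** The pair (b, sqrt tau p) indexed by Booleans, so that [rnorm_gE] applies to it. *)
Definition wpair (tau : R) b p (x : R) (i : bool) : R :=
  if i then b x else Num.sqrt tau * p x.

Definition wfun (tau : R) b p (x : R) : R := rnorm 0 (wpair tau b p x).

Lemma wfunE (tau : R) b p x : 0 <= tau ->
  wfun tau b p x = Num.sqrt (b x ^+ 2 + tau * p x ^+ 2).
Proof. by move=> t0; rewrite /wfun /rnorm big_bool/= add0r exprMn sqr_sqrtr. Qed.

(** The factor 2 arises because b and sqrt tau p each contribute L to the Lipschitz constant. *)
Lemma one_step_spec_wfun (m L be tau : R) u p b : 0 <= be -> 0 <= L -> 0 <= tau -> tau <= 1 ->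
  one_step_spec m L be u p b ->
  one_step_spec m (2 * L) be u p (wfun tau b p).
Proof.
move=> be0 L0 t0 t1 [uB uL uT pBL [bB bL]].
have LL : L <= 2 * L by rewrite ler_peMl// ler1n.
have st1 : Num.sqrt tau <= 1 by rewrite -sqrtr1 ler_wsqrtr.
split.
- by move=> x; have /andP[h1 h2] := uB x; rewrite h1 (le_trans h2).
- by move=> x y; apply: le_trans (uL x y) _; rewrite ler_wpM2r.
- by move=> x h; apply: le_trans (uT x h) _; rewrite ler_wpM2r// sqr_ge0.
- exact: bounded_lipschitz_le pBL.
split=> [x|x y]; last first.
  apply: le_trans (rnorm_dist _ _ (lexx 0)) _; rewrite big_bool/=.
  rewrite mulrDl mul1r mulrDl; apply: lerD; first exact: bL.
  rewrite -mulrBr normrM ger0_norm ?sqrtr_ge0//.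
  by apply: le_trans (pBL.2 x y); rewrite ler_piMl.
have /andP[h1 h2] := bB x; apply/andP; split.
  apply: le_trans h1 _; apply: le_trans (ler_norm _) _.
  exact: (@coord_le_rnorm _ _ 0 (wpair tau b p x) true).
rewrite wfunE// -(@ger0_norm _ (2 * L)) ?mulr_ge0// -sqrtr_sqr ler_wsqrtr//.
have bx : b x ^+ 2 <= L ^+ 2 by rewrite lerXn2// (le_trans be0).
have px : tau * p x ^+ 2 <= L ^+ 2.
  apply: (@le_trans _ _ (p x ^+ 2)); first by rewrite ler_piMl ?sqr_ge0.
  by rewrite -(real_normK (num_real (p x))) lerXn2// pBL.1.
have : 0 <= L ^+ 2 by exact: sqr_ge0.
by rewrite exprMn -natrX (_ : (2 ^ 2)%N = 4%N)//; lra.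
Qed.

Lemma wfun_heat (m L be tau d : R) u p b x : 0 <= be -> 0 <= L -> 0 <= tau -> tau <= 1 ->
  one_step_spec m L be u p b ->
  wfun tau (heat d b) (heat d p) x <= heat d (wfun tau b p) x.
Proof.
move=> be0 L0 t0 t1 spec; have [_ _ _ _ [wB wL]] := one_step_spec_wfun be0 L0 t0 t1 spec.
have wBL := bounded_lipschitz_of_bounds be0 wB wL.
have [_ _ _ pBL [bB bL]] := spec.
have bBL := bounded_lipschitz_of_bounds be0 bB bL.
pose q i z := wpair tau b p (x + d * z) i.
have iq i : gint (q i).
  by case: i; [exact: gint_affine bBL|apply: gintZ; exact: gint_affine pBL].
have := rnorm_gE (lexx 0) iq (gint_affine x d wBL).
apply: le_trans; rewrite /wfun le_eqVlt; apply/orP; left; apply/eqP.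
congr rnorm; apply/funext => -[] //=.
by rewrite /heat -gEZ//; exact: gint_affine pBL.
Qed.

Lemma Mfun_gauss1 (m L be B L' : R) u p b v : 0 < m -> m <= L -> 0 < be -> be <= L ->
  one_step_spec m L be u p b -> bounded_lipschitz B L' v ->
  (forall x, Mfun (u x) (Num.sqrt (b x ^+ 2 + p x ^+ 2)) <= v x) ->
  forall x, Mfun (heat 1 u x) (heat 1 b x) <= heat 1 v x.
Proof.
move=> m0 mL be0 beL spec vBL Mv x.
have L0 : 0 < L := lt_le_trans m0 mL.
have LL : L <= 2 * L by rewrite ler_peMl ?ler1n// ltW.
(* The steps are applied to [wfun], which obeys the bounds with 2 L. *)
have [C C0 HC] := Mfun_one_step m0 (le_trans mL LL) be0 (le_trans beL LL).
suff main (N : nat) : (0 < N)%N ->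
    Mfun (heat 1 u x) (heat 1 b x) <= heat 1 v x + C / Num.sqrt N%:R.
  apply/ler_addgt0Pr => e e0; pose N := (Num.trunc ((C / e) ^+ 2)).+1.
  apply: le_trans (main N isT) _; rewrite lerD2l.
  have N0 : 0 < Num.sqrt (N%:R : R) by rewrite sqrtr_gt0 ltr0n.
  rewrite ler_pdivrMr// mulrC -ler_pdivrMr//.
  have Ce : 0 <= C / e by rewrite ltW// divr_gt0.
  rewrite -(ger0_norm Ce) -sqrtr_sqr ler_wsqrtr//.
  by rewrite ltW// /N truncnS_gt.
move=> N0; have NR0 : 0 < N%:R :> R by rewrite ltr0n.
pose a (k : nat) : R := Num.sqrt (k%:R / N%:R).
have a2 k : a k ^+ 2 = k%:R / N%:R by rewrite sqr_sqrtr// divr_ge0.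
pose d : R := Num.sqrt (N%:R^-1).
have d2 : d ^+ 2 = N%:R^-1 by rewrite sqr_sqrtr// invr_ge0.
have d0 : 0 < d by rewrite sqrtr_gt0 invr_gt0.
have d1 : d <= 1 by rewrite -sqrtr1 ler_wsqrtr// invf_le1// ler1n.
(* For k = 0 the inner deviation vanishes, which [heat_comp] excludes; then the inner average is the
   identity. *)
have aS k w Bw Lw : bounded_lipschitz Bw Lw w -> heat d (heat (a k) w) = heat (a k.+1) w.
  move=> wBL; apply/funext => y; case: k => [|k].
    rewrite /a mul0r sqrtr0 heat0 /d /a -[1%:R]/1 mul1r.
    by [].
  have ak : 0 < a k.+1 by rewrite sqrtr_gt0 divr_gt0.
  have aSk : 0 < a k.+2 by rewrite sqrtr_gt0 divr_gt0.
  apply: (heat_comp y wBL ak aSk).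
  by rewrite d2 !a2 -(natr1 k.+1) mulrDl mul1r addrC.
have [uB uL uT pBL [bB bL]] := spec.
have uBL := bounded_lipschitz_of_bounds (ltW m0) uB uL.
have bBL := bounded_lipschitz_of_bounds (ltW be0) bB bL.
(* After k steps the variance k / N has been averaged and 1 - k / N still weighs p^2. For k = 0 this
   is the hypothesis; for k = N only b is left. *)
have key k : (k <= N)%N -> forall y,
    Mfun (heat (a k) u y) (wfun (1 - k%:R / N%:R) (heat (a k) b) (heat (a k) p) y)
    <= heat (a k) v y + k%:R * (C * d ^+ 3).
  elim: k => [_ y|k IH kN y].
    by rewrite /a !mul0r sqrtr0 !heat0 subr0 addr0 wfunE// mul1r.
  pose tau : R := 1 - k.+1%:R / N%:R.
  have t0 : 0 <= tau by rewrite subr_ge0 ler_pdivrMr// mul1r ler_nat.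
  have t1 : tau <= 1 by rewrite lerBlDl lerDr divr_ge0.
  have speck := one_step_spec_heat (a k) (ltW m0) (ltW be0) spec.
  have specw := one_step_spec_wfun (ltW be0) (ltW L0) t0 t1 speck.
  pose v' z := heat (a k) v z + k%:R * (C * d ^+ 3).
  have v'BL : bounded_lipschitz (B + k%:R * (C * d ^+ 3)) L' v'.
    have [h1 h2] := heat_bounded_lipschitz (a k) vBL.
    have kc : 0 <= k%:R * (C * d ^+ 3).
      by rewrite mulr_ge0// mulr_ge0 ?(ltW C0)// exprn_ge0// ltW.
    split=> [z|z z'].
      by apply: le_trans (ler_normD _ _) _; rewrite (ger0_norm kc) lerD2r.
    by rewrite /v' [X in `|X|](_ : _ = heat (a k) v z - heat (a k) v z'); [exact: h2|ring].
  (* Since d^2 = 1 / N, adding (d p)^2 to the square with weight 1 - (k + 1) / N restores the weight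
     1 - k / N of the induction hypothesis. *)
  have Mv' z : Mfun (heat (a k) u z) (Num.sqrt
     (wfun tau (heat (a k) b) (heat (a k) p) z ^+ 2 + (d * heat (a k) p z) ^+ 2)) <= v' z.
    apply: le_trans (IH (ltnW kN) z); rewrite le_eqVlt; apply/orP; left; apply/eqP.
    congr Mfun; rewrite !wfunE//; last first.
      by rewrite subr_ge0 ler_pdivrMr// mul1r ler_nat ltnW.
    rewrite sqr_sqrtr; last first.
      by apply: addr_ge0; [exact: sqr_ge0|apply: mulr_ge0 => //; exact: sqr_ge0].
    congr Num.sqrt; rewrite exprMn d2 /tau -(natr1 k).
    by field; rewrite gt_eqF.
  have := HC _ _ _ _ _ _ _ specw v'BL d0 d1 Mv' y.
  rewrite (aS k u _ _ uBL) => h.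
  have e : heat d v' y = heat (a k.+1) v y + k%:R * (C * d ^+ 3).
    rewrite -(aS k v _ _ vBL) {1}/heat gED ?gE_cst//; last exact: gint_cst.
    exact: gint_affine (heat_bounded_lipschitz (a k) vBL).
  rewrite e in h.
  (* M increases in y, and by Minkowski the norm of the averages is at most the average of the
     norm. *)
  apply: (@le_trans _ _ (Mfun (heat (a k.+1) u y)
     (heat d (wfun tau (heat (a k) b) (heat (a k) p)) y))).
    apply: Mfun_le.
    - have /andP[h1 _] := gE_affine_bounds (a k.+1) y uBL uB.
      exact: lt_le_trans h1.
    - exact: rnorm_ge0.
    - rewrite -(aS k b _ _ bBL) -(aS k p _ _ pBL).
      exact: (wfun_heat d y (ltW be0) (ltW L0) t0 t1 speck).
  by move: h; rewrite -natr1 mulrDl mul1r; lra.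
have := key N (leqnn N) x.
have -> : a N = 1 by rewrite /a divff ?sqrtr1// gt_eqF.
rewrite divff ?gt_eqF// subrr wfunE// mul0r addr0 sqrtr_sqr.
rewrite ger0_norm; last first.
  have /andP[h1 _] := gE_affine_bounds 1 x bBL bB.
  exact: le_trans (ltW be0) h1.
suff -> : N%:R * (C * d ^+ 3) = C / Num.sqrt N%:R by [].
rewrite exprSr d2 (_ : _ * _ = C * d); last by field; rewrite gt_eqF.
by rewrite /d sqrtrV.
Qed.

End gauss_dim1.

(** * Dimension n: averaging over one coordinate at a time *)

Section tensorization.
Context {R : realType} {n : nat}.
Implicit Types (x : 'rV[R]_n) (U V : 'rV[R]_n -> R) (i j : 'I_n).

Definition setc i x (t : R) : 'rV[R]_n := \row_j (if j == i then t else x ord0 j).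

Lemma setcE i x t j : setc i x t ord0 j = if j == i then t else x ord0 j.
Proof. by rewrite mxE. Qed.

Lemma setc_setc i x s t : setc i (setc i x s) t = setc i x t.
Proof. by apply/rowP => j; rewrite !setcE; case: eqP. Qed.

Lemma setcC i j x s t : i != j -> setc i (setc j x s) t = setc j (setc i x t) s.
Proof.
move=> ij; apply/rowP => k; rewrite !setcE.
by case: (eqVneq k i) => // ->; rewrite (negbTE ij).
Qed.

Lemma setc_id i x : setc i x (x ord0 i) = x.
Proof. by apply/rowP => j; rewrite setcE; case: eqP => [->|]. Qed.

(** Lipschitz along coordinate lines, the form in which averaging and measurability are treated
    coordinate by coordinate. *)
Definition bounded_coord_lipschitz (B L : R) U :=
  (forall x, `|U x| <= B) /\
  (forall i x s t, `|U (setc i x s) - U (setc i x t)| <= L * `|s - t|).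

Lemma bounded_coord_lipschitz_line (B L : R) U i x :
  bounded_coord_lipschitz B L U -> bounded_lipschitz B L (fun t => U (setc i x t)).
Proof. by move=> [UB UL]; split=> [t|s t]; [exact: UB|exact: UL]. Qed.

Lemma bounded_coord_lipschitzD (B L B' L' : R) U V :
  bounded_coord_lipschitz B L U -> bounded_coord_lipschitz B' L' V ->
  bounded_coord_lipschitz (B + B') (L + L') (fun x => U x + V x).
Proof.
move=> [UB UL] [VB VL]; split=> [x|i x s t].
  by apply: le_trans (ler_normD _ _) _; exact: lerD.
rewrite opprD addrACA mulrDl.
by apply: le_trans (ler_normD _ _) _; exact: lerD.
Qed.

Definition avg i U x : R := gE (fun t => U (setc i x t)).

Lemma avgE i U x : avg i U x = heat 1 (fun t => U (setc i x t)) 0.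
Proof. by rewrite /heat; under eq_fun do rewrite add0r mul1r. Qed.

Lemma gint_line (B L : R) U i x : bounded_coord_lipschitz B L U ->
  gint (fun t => U (setc i x t)).
Proof.
move=> /(bounded_coord_lipschitz_line i x) h.
exact: gint_bounded (bounded_lipschitz_measurable h) h.1.
Qed.

Lemma avg_setc i U x s : avg i U (setc i x s) = avg i U x.
Proof. by rewrite /avg; under eq_fun do rewrite setc_setc. Qed.

Lemma avg_bounded_coord_lipschitz (B L : R) i U : 0 <= L ->
  bounded_coord_lipschitz B L U -> bounded_coord_lipschitz B L (avg i U).
Proof.
move=> L0 UBL; have [UB UL] := UBL; split=> [x|j x s t].
  by apply: gE_norm_le => [|t]; [exact: gint_line UBL|exact: UB].
have [->|ij] := eqVneq j i; first by rewrite !avg_setc subrr normr0 mulr_ge0.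
rewrite /avg -gEB; [|exact: gint_line UBL|exact: gint_line UBL].
apply: gE_norm_le => [|z]; first by apply: gintB; exact: gint_line UBL.
have ij' : i != j by rewrite eq_sym.
by rewrite !(setcC x _ z ij'); exact: UL.
Qed.

Record nspec (m L : R) U (p : 'I_n -> 'rV[R]_n -> R) : Prop := NSpec {
  nspec_range : forall x, m <= U x <= L ;
  nspec_lip : forall i x s t, `|U (setc i x s) - U (setc i x t)| <= L * `|s - t| ;
  nspec_taylor : forall i x t h,
    `|U (setc i x (t + h)) - U (setc i x t) - h * p i (setc i x t)| <= L * h ^+ 2 ;
  nspec_grad : forall j, bounded_coord_lipschitz L L (p j) }.

Lemma nspec_bounded_coord_lipschitz (m L : R) U p : 0 <= m -> nspec m L U p ->
  bounded_coord_lipschitz L L U.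
Proof.
move=> m0 [Ur Ul _ _]; split=> // x; have /andP[h1 h2] := Ur x.
by rewrite ger0_norm// (le_trans m0).
Qed.

Definition avg_grad i (p : 'I_n -> 'rV[R]_n -> R) j x : R :=
  if j == i then 0 else avg i (p j) x.

Lemma nspec_avg (m L : R) i U p : 0 <= m -> 0 <= L -> nspec m L U p ->
  nspec m L (avg i U) (avg_grad i p).
Proof.
move=> m0 L0 spec; have UBL := nspec_bounded_coord_lipschitz m0 spec.
have [Ur Ul Ut pBL] := spec; split.
- by move=> x; apply: gE_bounded => [|t]; [exact: gint_line UBL|exact: Ur].
- exact: (avg_bounded_coord_lipschitz i L0 UBL).2.
- move=> j x t h; rewrite /avg_grad; have [->|ji] := eqVneq j i.
    by rewrite !avg_setc mulr0 subr0 subrr normr0 mulr_ge0// sqr_ge0.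
  have i1 y := gint_line i y UBL; have i3 := gintZ h (gint_line i (setc j x t) (pBL j)).
  rewrite /avg -gEZ; last exact: gint_line (pBL j).
  rewrite -(gEB (i1 _) (i1 _)) -(gEB (gintB (i1 _) (i1 _)) i3).
  apply: gE_norm_le; first exact: gintB (gintB (i1 _) (i1 _)) i3.
  have ij : i != j by rewrite eq_sym.
  by move=> z; rewrite !(setcC x _ z ij); exact: Ut.
- move=> j; rewrite /avg_grad; case: eqP => _; last exact: avg_bounded_coord_lipschitz.
  by split=> [x|k x s t]; rewrite ?subrr normr0 ?mulr_ge0.
Qed.

Definition Minv (ep : R) U (p : 'I_n -> 'rV[R]_n -> R) V :=
  forall x, Mfun (U x) (rnorm ep (p^~ x)) <= V x.

Lemma sumr_le_card (F : 'I_n -> R) (c : R) : (forall j, F j <= c) ->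
  \sum_j F j <= n%:R * c.
Proof.
move=> Fc; apply: (@le_trans _ _ (\sum_(j < n) c)); first exact: ler_sum.
by rewrite sumr_const card_ord mulr_natl.
Qed.

(** On a line in direction i, p_i plays the derivative and the other partials together with ep form
    b, which is at least sqrt ep > 0. Minkowski then moves the average inside b. *)
Lemma Minv_avg (m L B L' ep : R) i U p V : 0 < m -> m <= L -> 0 < ep ->
  nspec m L U p -> bounded_coord_lipschitz B L' V ->
  Minv ep U p V -> Minv ep (avg i U) (avg_grad i p) (avg i V).
Proof.
move=> m0 mL ep0 spec VBL inv x; have L0 : 0 < L := lt_le_trans m0 mL.
have UBL := nspec_bounded_coord_lipschitz (ltW m0) spec.
have [Ur Ul Ut pBL] := spec.
pose q (t : R) j : R := if j == i then 0 else p j (setc i x t).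
pose b (t : R) : R := rnorm ep (q t).
(* Dominates L, the bound sqrt ep + n L of b and its Lipschitz constant n L. *)
pose L2 : R := Num.sqrt ep + n%:R * L + L.
have sep : 0 < Num.sqrt ep by rewrite sqrtr_gt0.
have nL0 : 0 <= n%:R * L by rewrite mulr_ge0// ltW.
have LL2 : L <= L2 by rewrite lerDr addr_ge0// ltW.
have nLL2 : n%:R * L <= L2 by rewrite /L2; lra.
have qle t j : `|q t j| <= L.
  by rewrite /q; case: ifP => _; [rewrite normr0 ltW|exact: (pBL j).1].
have bspec : one_step_spec m L2 (Num.sqrt ep) (fun t => U (setc i x t))
    (fun t => p i (setc i x t)) b.
  split.
  - by move=> t; have /andP[h1 h2] := Ur (setc i x t); rewrite h1 (le_trans h2).
  - by move=> s t; apply: le_trans (Ul i x s t) _; rewrite ler_wpM2r.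
  - by move=> t h; apply: le_trans (Ut i x t h) _; rewrite ler_wpM2r// sqr_ge0.
  - apply: (@bounded_lipschitz_le _ L L) => //.
    exact: bounded_coord_lipschitz_line.
  - split=> [t|s t].
      rewrite sqrt_le_rnorm/=.
      apply: le_trans (rnorm_le_sum (q t) (fun=> 0) (ltW ep0)) _.
      rewrite /rnorm big1 ?addr0; last by move=> j _; rewrite expr0n.
      rewrite /L2 -addrA lerD2l.
      apply: (@le_trans _ _ (n%:R * L)); last by rewrite lerDl ltW.
      by apply: sumr_le_card => j; rewrite subr0.
    apply: le_trans (rnorm_dist _ _ (ltW ep0)) _.
    apply: (@le_trans _ _ (n%:R * (L * `|s - t|))); last first.
      by rewrite mulrA ler_wpM2r.
    apply: sumr_le_card => j; rewrite /q; case: ifP => _; last exact: (pBL j).2.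
    by rewrite subrr normr0 mulr_ge0// ltW.
have := Mfun_gauss1 m0 (le_trans mL LL2) sep _ bspec
  (bounded_coord_lipschitz_line i x VBL) _ 0.
rewrite -!avgE => h.
apply: le_trans (h _ _); last 2 first.
- by rewrite /L2 -addrA lerDl addr_ge0// ltW.
- move=> t; apply: le_trans (inv (setc i x t)); rewrite le_eqVlt; apply/orP; left.
  apply/eqP; congr Mfun; rewrite sqr_rnorm ?(ltW ep0)// /rnorm; congr Num.sqrt.
  rewrite -addrA; congr (_ + _); rewrite [RHS](bigD1 i)//= [in LHS](bigD1 i)//=.
  rewrite /q eqxx expr0n/= add0r addrC; congr (_ + _).
  by apply: eq_bigr => j /negbTE ->.
apply: Mfun_le.
- by have /andP[h1 _] := nspec_range (nspec_avg i (ltW m0) (ltW L0) spec) x; exact: lt_le_trans h1.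
- exact: rnorm_ge0.
have [_ _ _ _ [bB bL]] := bspec.
have bBL := bounded_lipschitz_of_bounds (ltW sep) bB bL.
have iq j : gint (q^~ j).
  rewrite /q; case: (eqVneq j i) => _; first exact: gint_cst.
  exact: gint_line (pBL j).
have -> : heat 1 b 0 = gE b.
  by rewrite /heat; congr gE; apply/funext => t; rewrite add0r mul1r.
apply: le_trans (rnorm_gE (ltW ep0) iq _).
  rewrite le_eqVlt; apply/orP; left; apply/eqP; congr rnorm; apply/funext => j.
  rewrite /avg_grad /q; case: (eqVneq j i) => _ //.
  by rewrite gE_cst.
exact: gint_bounded (bounded_lipschitz_measurable bBL) bBL.1.
Qed.

Definition avgs (r : seq 'I_n) U := foldl (fun W i => avg i W) U r.

Lemma ln_avgs_le (m L B L' ep : R) r U p V x : 0 < m -> m <= L -> 0 < ep -> 0 <= L' ->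
  nspec m L U p -> bounded_coord_lipschitz B L' V -> Minv ep U p V ->
  ln (avgs r U x) <= avgs r V x.
Proof.
move=> m0 mL ep0 L'0; elim: r U p V => [|i r IH] U p V spec VBL inv /=.
  exact: le_trans (ln_le_Mfun _ _) (inv x).
apply: IH (nspec_avg i (ltW m0) _ spec) (avg_bounded_coord_lipschitz i L'0 VBL) _.
  exact: le_trans (ltW m0) mL.
exact: Minv_avg spec VBL inv.
Qed.

Lemma avgs_cstD (B L : R) r U (c : R) x : 0 <= L -> bounded_coord_lipschitz B L U ->
  avgs r (fun y => U y + c) x = avgs r U x + c.
Proof.
move=> L0; elim: r U => //= i r IH U UBL.
rewrite -IH; last exact: avg_bounded_coord_lipschitz.
congr (avgs r _ x); apply/funext => y.
by rewrite /avg gED ?gE_cst//; [exact: gint_line UBL|exact: gint_cst].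
Qed.

Definition indep_coord i U := forall x s, U (setc i x s) = U x.

Lemma avg_indep_coord i j U : indep_coord j U -> indep_coord j (avg i U).
Proof.
move=> Uj x s; have [->|ij] := eqVneq j i; first exact: avg_setc.
rewrite /avg; congr gE; apply/funext => t.
by rewrite setcC 1?eq_sym// Uj.
Qed.

Lemma avgs_indep_coord r U j : j \in r -> indep_coord j (avgs r U).
Proof.
have aux k s W : indep_coord k W -> indep_coord k (avgs s W).
  by elim: s W => //= i s IH W Wj; apply: IH; exact: avg_indep_coord.
elim: r U => //= i r IH U; rewrite inE => /predU1P[->|/IH]; last exact.
apply: aux => x s; exact: avg_setc.
Qed.

(** The coordinates of x are exchanged for those of y one after another. *)
Lemma indep_coord_cst U : (forall j, indep_coord j U) -> forall x y, U x = U y.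
Proof.
move=> Uj x y.
have key (r : seq 'I_n) : U (\row_j (if j \in r then y ord0 j else x ord0 j)) = U x.
  elim: r => [|i r IH].
    by congr U; apply/rowP => j; rewrite mxE.
  rewrite -IH -(Uj i (\row_j (if j \in r then y ord0 j else x ord0 j)) (y ord0 i)).
  congr U; apply/rowP => j; rewrite setcE !mxE inE.
  by case: (eqVneq j i) => // ->.
rewrite -(key (enum 'I_n)); congr U; apply/rowP => j.
by rewrite mxE mem_enum.
Qed.

Lemma avgs_enum_cst U x y : avgs (enum 'I_n) U x = avgs (enum 'I_n) U y.
Proof.
by apply: indep_coord_cst => j; apply: avgs_indep_coord; rewrite mem_enum.
Qed.

End tensorization.

(** * Measurability of functions Lipschitz in one variable *)

Section caratheodory_measurable.
Context {d : measure_display} {S : measurableType d} {R : realType}.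

Lemma measurable_fun_countable_glue (Z : S -> int) (G : S -> int -> R) :
  (forall k, measurable (Z @^-1` [set k])) ->
  (forall k, measurable_fun setT (G ^~ k)) ->
  measurable_fun setT (fun s => G s (Z s)).
Proof.
move=> mZ mG _ Y mY; rewrite setTI.
rewrite (_ : _ @^-1` Y = \bigcup_k (Z @^-1` [set k] `&` (G ^~ k) @^-1` Y)).
  apply: countable_bigcupT_measurable => [|k]; first exact: countableP.
  by apply: measurableI => //; rewrite -[X in measurable X]setTI; exact: mG.
apply/seteqP; split=> [s /= Ys|s [k _ [/= -> //]]].
by exists (Z s).
Qed.

(** Z is approximated within 1 / (N + 1) by a measurable function with countably many values; the
    Lipschitz bound carries the limit. *)
Lemma measurable_fun_caratheodory (G : S -> R -> R) (L : R) (Z : S -> R) :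
  (forall t, measurable_fun setT (G ^~ t)) ->
  (forall s t t', `|G s t - G s t'| <= L * `|t - t'|) ->
  measurable_fun setT Z -> measurable_fun setT (fun s => G s (Z s)).
Proof.
move=> mG GL mZ.
pose h (N : nat) s := G s ((Num.floor (N.+1%:R * Z s))%:~R / N.+1%:R).
apply: (@measurable_fun_cvg _ _ _ _ h) => [N|s _].
  apply: (@measurable_fun_countable_glue (fun s => Num.floor (N.+1%:R * Z s))
    (fun s k => G s (k%:~R / N.+1%:R))) => k; last exact: mG.
  rewrite (_ : _ @^-1` _ = (fun s => N.+1%:R * Z s) @^-1` `[k%:~R, (k + 1)%:~R[).
    rewrite -[X in measurable X]setTI.
    by apply: (@measurable_funM _ _ _ _ (cst N.+1%:R)) => //; exact: measurable_itv.
  apply/seteqP; split=> s' /=; rewrite in_itv/=.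
    by move=> <-; rewrite floor_le floorD1_gt.
  by move=> h'; apply: floor_def.
apply/cvgrPdist_le => e e0; near=> N.
apply: le_trans (GL _ _ _) _.
have N0 : 0 < N.+1%:R :> R by rewrite ltr0n.
have dist : `|Z s - (Num.floor (N.+1%:R * Z s))%:~R / N.+1%:R| <= N.+1%:R^-1.
  have h1 := floor_le (N.+1%:R * Z s); have h2 := floorD1_gt (N.+1%:R * Z s).
  rewrite intrD in h2; move: h1 h2; set q := (Num.floor _)%:~R => h1 h2.
  have -> : Z s - q / N.+1%:R = (N.+1%:R * Z s - q) / N.+1%:R by field; rewrite gt_eqF.
  rewrite normrM normfV (gtr0_norm N0) -[leRHS]mul1r ler_wpM2r ?invr_ge0//.
  by rewrite ger0_norm ?subr_ge0// lerBlDl ltW.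
apply: (@le_trans _ _ ((`|L| + 1) * N.+1%:R^-1)).
  have L1 : 0 <= `|L| + 1 by rewrite addr_ge0.
  apply: le_trans (ler_wpM2l L1 dist).
  by rewrite ler_wpM2r// (le_trans (ler_norm L))// lerDl.
rewrite ler_pdivrMr// -ler_pdivrMl//.
apply: (@le_trans _ _ N%:R); last by rewrite ler_nat.
by near: N; exact: nbhs_infty_ger.
Unshelve. all: by end_near.
Qed.

End caratheodory_measurable.

(** * Measurability from coordinates, and independence as a product law *)

Section law_of_vector.
Context {R : realType} {n : nat}.

(** Only the coordinates of Y are assumed measurable. They are inserted one by one into a fixed
    vector x0, each insertion by [measurable_fun_caratheodory]. *)
Lemma measurable_coord_lipschitz {d : measure_display} {S : measurableType d}
    (Y : S -> 'rV[R]_n) (B L : R) (W : 'rV[R]_n -> R) :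
  (forall j, measurable_fun setT (fun s => Y s ord0 j)) ->
  bounded_coord_lipschitz B L W -> measurable_fun setT (fun s => W (Y s)).
Proof.
move=> mY WBL.
pose mix (r : seq 'I_n) (y x0 : 'rV[R]_n) : 'rV[R]_n :=
  \row_j (if j \in r then y ord0 j else x0 ord0 j).
have key r : forall x0, measurable_fun setT (fun s => W (mix r (Y s) x0)).
  elim: r => [|i r IH] x0.
    rewrite (_ : (fun s => _) = cst (W x0)) //.
    by apply/funext => s; congr W; apply/rowP => j; rewrite mxE.
  have [ir|ir] := boolP (i \in r).
    rewrite (_ : (fun s => _) = (fun s => W (mix r (Y s) x0))) //.
    apply/funext => s; congr W; apply/rowP => j; rewrite !mxE inE.
    by case: eqP => //= ->; rewrite ir.
  have := @measurable_fun_caratheodory _ S R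
    (fun s t => W (setc i (mix r (Y s) x0) t)) L (fun s => Y s ord0 i).
  rewrite (_ : (fun s => W (setc i (mix r (Y s) x0) (Y s ord0 i))) =
    (fun s => W (mix (i :: r) (Y s) x0))); last first.
    apply/funext => s; congr W; apply/rowP => j; rewrite setcE !mxE inE.
    by case: (eqVneq j i) => [->|].
  apply => [t|s t t'|]; [|exact: WBL.2|exact: mY].
  rewrite (_ : (fun s => _) = (fun s => W (mix r (Y s) (setc i x0 t)))); first exact: IH.
  apply/funext => s; congr W; apply/rowP => j; rewrite setcE !mxE.
  by case: (eqVneq j i) => [->|//]; rewrite (negbTE ir).
have := key (enum 'I_n) 0; congr (measurable_fun _ _); apply/funext => s.
by congr W; apply/rowP => j; rewrite mxE mem_enum.
Qed.

Lemma integral_indep {d d0 d1 : measure_display} {T : measurableType d}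
    {T0 : measurableType d0} {T1 : measurableType d1}
    (P : probability T R) (N : probability T1 R)
    (phi : T -> T0) (Z : T -> T1) (h : T0 * T1 -> R) :
  measurable_fun setT phi -> measurable_fun setT Z ->
  (forall A B, measurable A -> measurable B ->
    P (phi @^-1` A `&` Z @^-1` B) = (P (phi @^-1` A) * N B)%E) ->
  measurable_fun setT h -> (forall x, 0 <= h x) ->
  (\int[P]_w (h (phi w, Z w))%:E = \int[P]_w \int[N]_z (h (phi w, z))%:E)%E.
Proof.
move=> mphi mZ indep mh h0.
pose Phi w := (phi w, Z w).
have mPhi : measurable_fun setT Phi by exact: measurable_fun_pair.
have mEh : measurable_fun setT (EFin \o h) by exact/measurable_EFinP.
pose PhiM : {mfun T >-> (T0 * T1)%type} := mfun_Sub (mem_set mPhi).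
pose phiM : {mfun T >-> T0} := mfun_Sub (mem_set mphi).
transitivity (\int[distribution P PhiM]_x (h x)%:E)%E.
  by rewrite ge0_integral_pushforward// => x _; rewrite lee_fin.
transitivity (\int[distribution P phiM \x N]_x (h x)%:E)%E.
  apply: eq_measure_integral => A mA _; apply/esym.
  apply: (product_measure_unique (m' := distribution P PhiM)) => //.
rewrite fubini_tonelli1//.
rewrite ge0_integral_pushforward//.
- by apply: measurable_fun_fubini_tonelli_F => // x; rewrite lee_fin.
- by move=> x _; apply: integral_ge0 => z _; rewrite lee_fin.
Qed.

End law_of_vector.

(** * Expectations of functions of X as iterated averages *)

Section gaussian_law.
Context {R : realType} {n : nat} {d : measure_display} {T : measurableType d}.
Variables (P : probability T R) (X : T -> 'rV[R]_n).
Hypothesis gaussX : standard_gaussian_vector P X.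
Implicit Types (i j : 'I_n) (W : 'rV[R]_n -> R).
Local Notation gam := (@normal_prob R 0 1).

(** A pi-system that generates the events determined by the coordinates other than i. *)
Definition cylinder i : set (set T) := [set A | exists (J : {set 'I_n}) (B : 'I_n -> set R),
  [/\ i \notin J, forall j, measurable (B j) &
      A = [set w | forall j, j \in J -> B j (X w ord0 j)]]].

Lemma measurable_coord_preimage j (B : set R) : measurable B ->
  measurable ((fun w => X w ord0 j) @^-1` B).
Proof.
by move=> mB; rewrite -[X in measurable X]setTI; exact: (sgv_measurable gaussX).
Qed.

Lemma cylinder_measurable i : cylinder i `<=` measurable.
Proof.
move=> A [J [B [_ mB ->]]].
rewrite (_ : [set w | _] = \bigcap_(j in [set j | j \in J]) ((fun w => X w ord0 j) @^-1` B j)).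
  apply: fin_bigcap_measurable => [|j _]; first exact: finite_finset.
  exact: measurable_coord_preimage.
by apply/seteqP; split=> w /= h j; exact: h.
Qed.

Lemma cylinder_setI i : setI_closed (cylinder i).
Proof.
move=> A1 A2 [J1 [B1 [iJ1 mB1 ->]]] [J2 [B2 [iJ2 mB2 ->]]].
exists (J1 :|: J2)%SET, (fun j => (if j \in J1 then B1 j else setT) `&`
  (if j \in J2 then B2 j else setT)); split.
- by rewrite inE negb_or iJ1.
- by move=> j; apply: measurableI; case: ifP.
- apply/seteqP; split=> w /=.
    move=> [h1 h2] j _; split; case: ifPn => // jJ; [exact: h1|exact: h2].
  move=> h; split=> j jJ.
    by have [] := h j; rewrite ?inE ?jJ.
  by have [] := h j; rewrite ?inE ?jJ ?orbT.
Qed.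

(** Both sides are finite measures in A. On a cylinder over J they agree by independence of the
    coordinates in J with i added, and a measure is determined by its values on a generating
    pi-system. *)
Lemma cylinder_indep i (B : set R) : measurable B -> forall A, <<s cylinder i >> A ->
  P (A `&` (fun w => X w ord0 i) @^-1` B) = (P A * gam B)%E.
Proof.
move=> mB.
have mXB := measurable_coord_preimage i mB.
have gB : gam B = (fine (gam B))%:E by rewrite fineK//; exact: fin_num_measure.
have gB0 : 0 <= fine (gam B) by rewrite fine_ge0.
have cT : cylinder i setT.
  exists finset.set0, (fun=> setT); split; rewrite ?inE//.
  by apply/seteqP; split=> w //= _ j; rewrite inE.
pose m2 := mscale (NngNum gB0) P.
have key A : cylinder i A -> mrestr P mXB A = m2 A.
  move=> [J [C [iJ mC ->]]].
  rewrite /m2 /mscale /mrestr/= -gB.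
  have [_ marg ind] := gaussX.
  pose C' j := if j == i then B else C j.
  have mC' j : measurable (C' j) by rewrite /C'; case: ifP.
  rewrite (ind J C mC).
  transitivity (P [set w | forall j, j \in (i |: J)%SET -> C' j (X w ord0 j)]).
    congr (P _); apply/seteqP; split=> w /=.
      move=> [h1 h2] j; rewrite !inE /C'; case: (eqVneq j i) => [-> //|ji /= jJ].
      exact: h1.
    move=> h; split=> [j jJ|].
      have := h j; rewrite !inE jJ orbT /C' => /(_ isT).
      by case: eqVneq jJ iJ => // -> ->.
    by have := h i; rewrite !inE eqxx /C' eqxx; exact.
  rewrite (ind _ C' mC') big_setU1//= /C' eqxx -(marg i B mB); congr (_ * _)%E.
  apply: eq_bigr => j jJ; case: (eqVneq j i) => // e.
  by move: jJ iJ; rewrite e => ->.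
move=> A sA.
have := @g_sigma_algebra_measure_unique _ R T (cylinder i) (@cylinder_measurable i)
  (fun=> setT) (fun=> cT) _ (mrestr P mXB) m2 (@cylinder_setI i) key _ A sA.
move=> e; have {e} : mrestr P mXB A = m2 A.
  apply: e.
  - by apply/seteqP; split=> // w _; exists 0%N.
  - move=> _; apply: (@le_lt_trans _ _ 1%E); last exact: ltry.
    exact: (probability_le1 P (measurableI _ _ measurableT mXB)).
by rewrite /m2 /mscale /mrestr/= -gB muleC.
Qed.

Definition PE W : R := \int[P]_w W (X w).

Lemma measurable_bounded_coord_lipschitz (B L : R) W : bounded_coord_lipschitz B L W ->
  measurable_fun setT (fun w => W (X w)).
Proof. by apply: measurable_coord_lipschitz; exact: (sgv_measurable gaussX). Qed.

Lemma integrable_bounded_coord_lipschitz (B L : R) W : bounded_coord_lipschitz B L W ->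
  P.-integrable setT (EFin \o (fun w => W (X w))).
Proof.
move=> WBL; apply: measurable_bounded_integrable => //.
- by rewrite [ltLHS]probability_setT ltry.
- exact: measurable_bounded_coord_lipschitz WBL.
- exists B; split; first exact: num_real.
  by move=> y By z _; exact: le_trans (WBL.1 _) (ltW By).
Qed.

Lemma PE_avg (B L : R) i W : 0 <= L -> bounded_coord_lipschitz B L W ->
  PE W = PE (avg i W).
Proof.
move=> L0 WBL.
(* The first factor is the sample space with the smaller sigma-algebra and phi is the identity, so
   no vector of n - 1 coordinates has to be formed. B is added for nonnegativity. *)
pose T0 := g_sigma_algebraType (cylinder i).
pose phi : T -> T0 := id.
pose Z w := X w ord0 i.
pose h (wz : T0 * R) := W (setc i (X wz.1) wz.2) + B.
have h0 wz : 0 <= h wz.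
  by rewrite /h -lerBlDr sub0r; have := WBL.1 (setc i (X wz.1) wz.2); rewrite ler_norml => /andP[].
have mphi : measurable_fun setT phi.
  move=> _ Y mY; rewrite setTI.
  have := @smallest_sub _ (sigma_algebra setT) (cylinder i) measurable.
  apply => //; first exact: sigma_algebra_measurable.
  exact: cylinder_measurable.
have mZ : measurable_fun setT Z by exact: (sgv_measurable gaussX).
have mXj j : j != i -> measurable_fun setT (fun w : T0 => X w ord0 j).
  move=> ji _ Y mY; rewrite setTI; apply: sub_sigma_algebra.
  exists [set j]%SET, (fun=> Y); split => //; first by rewrite inE eq_sym.
  by apply/seteqP; split=> w /= => [Yw k|]; [rewrite inE => /eqP ->|apply; rewrite inE].
have mh : measurable_fun setT h.
  apply: measurable_funD => //.
  apply: (@measurable_coord_lipschitz _ _ _ _ (fun wz : T0 * R => setc i (X wz.1) wz.2)) WBL.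
  move=> j; have [->|ji] := eqVneq j i.
    rewrite (_ : (fun s => _) = snd); first exact: measurable_snd.
    by apply/funext => s; rewrite setcE eqxx.
  rewrite (_ : (fun s => _) = (fun w : T0 => X w ord0 j) \o fst).
    exact: measurableT_comp (mXj j ji) measurable_fst.
  by apply/funext => s; rewrite setcE (negbTE ji).
have indep A C : measurable A -> measurable C ->
    P (phi @^-1` A `&` Z @^-1` C) = (P (phi @^-1` A) * gam C)%E.
  by move=> mA mC; exact: cylinder_indep.
have := @integral_indep R d _ _ T (g_sigma_algebraType (cylinder i)) _ P (normal_prob 0 1)
  phi Z h mphi mZ indep mh h0.
have avgBL := avg_bounded_coord_lipschitz i L0 WBL.
have iW := integrable_bounded_coord_lipschitz WBL.
have iA := integrable_bounded_coord_lipschitz avgBL.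
have icB : P.-integrable setT (EFin \o cst B) by exact: finite_measure_integrable_cst.
have inner w : (\int[gam]_z (h (phi w, z))%:E)%E = (avg i W (X w) + B)%:E.
  rewrite gE_fin /h/=.
    by rewrite gED ?gE_cst//; [exact: gint_line WBL|exact: gint_cst].
  by apply: gintD; [exact: gint_line WBL|exact: gint_cst].
under [in RHS]eq_integral do rewrite inner.
have outer w : h (phi w, Z w) = W (X w) + B by rewrite /h /= setc_id.
under [in LHS]eq_integral do rewrite outer.
move=> e; have : \int[P]_w (W (X w) + B) = \int[P]_w (avg i W (X w) + B).
  by rewrite /Rintegral e.
by rewrite !RintegralD// => /addIr.
Qed.

Lemma PE_avgs (B L : R) r W : 0 <= L -> bounded_coord_lipschitz B L W ->
  PE W = PE (avgs r W).
Proof.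
move=> L0; elim: r W => //= i r IH W WBL.
by rewrite (PE_avg i L0 WBL); apply: IH; exact: avg_bounded_coord_lipschitz.
Qed.

Lemma PE_avgs_enum (B L : R) W x : 0 <= L -> bounded_coord_lipschitz B L W ->
  PE W = avgs (enum 'I_n) W x.
Proof.
move=> L0 WBL; rewrite (PE_avgs (enum 'I_n) L0 WBL) /PE.
under eq_Rintegral do rewrite (avgs_enum_cst W _ x).
by rewrite Rintegral_cst// [X in fine X]probability_setT mulr1.
Qed.

Lemma expectation_PE (B L : R) W : bounded_coord_lipschitz B L W ->
  ('E_P[fun w => W (X w)] = (PE W)%:E)%E.
Proof.
move=> /integrable_bounded_coord_lipschitz iW.
by rewrite unlock /PE /Rintegral fineK//; exact: integrable_fin_num.
Qed.

End gaussian_law.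

(** * Bounds for test functions, and the limit ep to 0 *)

Section test_functions.
Context {R : realType} {n : nat}.
Implicit Types (f g : 'rV[R]_n -> R) (x : 'rV[R]_n) (i j : 'I_n).

(** Relative to a fixed K, so that the support of f serves its partial derivatives too. *)
Definition vanishes_off (K : set 'rV[R]_n) g := forall x, ~ K x -> g x = 0.

Lemma partial_vanishes_off (K : set 'rV[R]_n) i g : closed K ->
  vanishes_off K g -> vanishes_off K (partial i g).
Proof.
move=> clK gK x Kx; rewrite /partial (@near_eq_derive _ _ _ g (cst 0)).
  exact: derive_cst.
have : nbhs x (~` K) by apply: open_nbhs_nbhs; split => //; exact: closed_openC.
by apply: filterS => y Ky; exact: gK.
Qed.

Lemma vanishes_off_bounded (K : set 'rV[R]_n) g : compact K -> continuous g ->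
  vanishes_off K g -> exists2 B : R, 0 <= B & forall x, `|g x| <= B.
Proof.
move=> cK cg gK.
have : compact (g @` K).
  by apply: continuous_compact => //; exact: continuous_subspaceT.
move=> /compact_bounded[B [_ gB]]; exists (`|B| + 1); first by rewrite addr_ge0.
move=> x; have [Kx|/gK ->] := pselect (K x); last by rewrite normr0 addr_ge0.
apply: gB; last by exists x.
by rewrite (le_lt_trans (ler_norm B))// ltrDl.
Qed.

Lemma is_derive_line g i x (t : R) : (forall y, differentiable g y) ->
  is_derive t 1 (fun s => g (setc i x s)) (partial i g (setc i x t)).
Proof.
move=> dg; pose e : 'rV[R]_n := delta_mx ord0 i.
have E : (fun h : R => h^-1 *: (((fun s => g (setc i x s)) \o shift t) (h *: 1)
      - g (setc i x t))) =
    (fun h : R => h^-1 *: ((g \o shift (setc i x t)) (h *: e) - g (setc i x t))).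
  apply/funext => h; congr (_ *: (g _ - _)); apply/rowP => j.
  rewrite !mxE/=; case: (eqVneq j i) => _; last by rewrite mulr0 add0r.
  by rewrite mulr1 /GRing.scale/= mulr1.
have := diff_derivable (v := e) (dg (setc i x t)); rewrite /derivable -E => dl.
apply: DeriveDef; first exact: dl.
by rewrite /partial /derive -E.
Qed.

Lemma line_lipschitz (phi dphi : R -> R) (L : R) :
  (forall t : R, is_derive t 1 phi (dphi t)) -> (forall t, `|dphi t| <= L) ->
  forall s t, `|phi s - phi t| <= L * `|s - t|.
Proof.
move=> phid dL.
have key s t : s <= t -> `|phi t - phi s| <= L * `|t - s|.
  move=> st; have [c _ ->] := derive_mean_value st phid.
  by rewrite normrM ler_wpM2r.
move=> s t; have [st|/ltW ts] := leP s t; last exact: key.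
by rewrite distrC (distrC s); exact: key.
Qed.

(** The mean value theorem leaves (dphi c - dphi t) h with |c - t| <= |h|. *)
Lemma line_taylor (phi dphi : R -> R) (L : R) :
  (forall t : R, is_derive t 1 phi (dphi t)) ->
  (forall s t, `|dphi s - dphi t| <= L * `|s - t|) ->
  forall t h, `|phi (t + h) - phi t - h * dphi t| <= L * h ^+ 2.
Proof.
move=> phid dL t h.
have [c cth e] : exists2 c, `|c - t| <= `|h| & phi (t + h) - phi t = dphi c * h.
  have [h0|/ltW h0] := leP 0 h.
    have [|c /andP[c1 c2] e] := derive_mean_value _ phid (a := t) (b := t + h).
      by rewrite lerDl.
    exists c; last by rewrite e addrAC subrr add0r.
    by rewrite !ger0_norm ?subr_ge0// lerBlDl.
  have [|c /andP[c1 c2] e] := derive_mean_value _ phid (a := t + h) (b := t).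
    by rewrite gerDl.
  exists c; last by rewrite -opprB e; ring.
  rewrite distrC ger0_norm ?subr_ge0// ler0_norm//; lra.
rewrite e (_ : _ - _ = (dphi c - dphi t) * h); last by ring.
rewrite normrM -(real_normK (num_real h)) expr2 mulrA ler_wpM2r//.
have L0 : 0 <= L.
  have := dL 1 0; rewrite subr0 normr1 mulr1; exact: le_trans.
by apply: le_trans (dL c t) _; rewrite ler_wpM2l.
Qed.

Lemma bounded_coord_lipschitz_addr (B L c : R) g : bounded_coord_lipschitz B L g ->
  bounded_coord_lipschitz (B + `|c|) L (fun x => g x + c).
Proof.
move=> [gB gL]; split=> [x|i x s t]; last by rewrite opprD addrACA subrr addr0; exact: gL.
by apply: le_trans (ler_normD _ _) _; rewrite lerD2r.
Qed.

Record C2_bounded (B : R) f : Prop := C2Bounded {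
  C2_ge0 : 0 <= B ;
  C2_diff : forall x, differentiable f x ;
  C2_diff_partial : forall i x, differentiable (partial i f) x ;
  C2_bound : forall x, `|f x| <= B ;
  C2_bound_partial : forall i x, `|partial i f x| <= B ;
  C2_bound_partial2 : forall i j x, `|partial j (partial i f) x| <= B }.

Lemma finite_family_bound (I : finType) (g : I -> 'rV[R]_n -> R) :
  (forall k, exists2 B : R, 0 <= B & forall x, `|g k x| <= B) ->
  exists2 B : R, 0 <= B & forall k x, `|g k x| <= B.
Proof.
move=> gB; pose b k := xget 0 [set B : R | 0 <= B /\ forall x, `|g k x| <= B].
have bP k : 0 <= b k /\ forall x, `|g k x| <= b k.
  rewrite /b; case: xgetP => [B -> []//|h].
  by have [B B0 gBk] := gB k; have := h B; case.
exists (\sum_k b k); first by rewrite sumr_ge0// => k _; exact: (bP k).1.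
move=> k x; apply: le_trans ((bP k).2 x) _; rewrite (bigD1 k)//= lerDl.
by rewrite sumr_ge0// => j _; exact: (bP j).1.
Qed.

Lemma test_function_C2_bounded f : test_function f -> exists B : R, C2_bounded B f.
Proof.
move=> [smf cK0]; pose K := closure [set x | f x != 0].
have cK : compact K by [].
have clK : closed K by exact: closed_closure.
have f0 : vanishes_off K f.
  move=> x Kx; apply/eqP/negPn/negP => fx; apply: Kx; exact: subset_closure.
have /= [df _] := smf 1%N.
(* Level 3 of [Ck] makes the second partials differentiable, hence continuous and bounded on K. *)
have df1 i : (forall x, differentiable (partial i f) x) /\
    forall j, forall x, differentiable (partial j (partial i f)) x.
  have /= [_ /(_ i) [h1 h2]] := smf 3%N; split => // j x; have [h3 _] := h2 j; exact: h3.
have cont g : (forall x, differentiable g x) -> continuous g.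
  by move=> dg x; exact: differentiable_continuous.
have [B0 B00 fB] := vanishes_off_bounded cK (cont _ df) f0.
have [B1 B10 pB] : exists2 B : R, 0 <= B & forall i x, `|partial i f x| <= B.
  apply: finite_family_bound => i.
  apply: (vanishes_off_bounded cK (cont _ (df1 i).1)).
  exact: partial_vanishes_off.
have [B2 B20 ppB] : exists2 B : R, 0 <= B &
    forall ij x, `|partial ij.2 (partial ij.1 f) x| <= B.
  apply: (@finite_family_bound ('I_n * 'I_n)%type) => -[i j].
  apply: (vanishes_off_bounded cK (cont _ ((df1 i).2 j))).
  by apply: partial_vanishes_off => //; exact: partial_vanishes_off.
exists (B0 + B1 + B2); split.
- by rewrite !addr_ge0.
- by [].
- by move=> i; exact: (df1 i).1.
- by move=> x; apply: le_trans (fB x) _; rewrite -addrA lerDl addr_ge0.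
- by move=> i x; apply: le_trans (pB i x) _; rewrite addrAC lerDr addr_ge0.
- by move=> i j x; apply: le_trans (ppB (i, j) x) _; rewrite lerDr addr_ge0.
Qed.

Variables (B : R) (f : 'rV[R]_n -> R).
Hypothesis fC2 : C2_bounded B f.

Let U x : R := expR (f x).
Let p i x : R := expR (f x) * partial i f x.
(** A common bound for e^f, for its partials and for the derivatives of those, whose factors next to
    e^f are at most 1, B and B^2 + B. *)
Let LU : R := expR B * (1 + B + B ^+ 2).

Lemma C2_f_bcl : bounded_coord_lipschitz B B f.
Proof.
split=> [x|i x]; first exact: C2_bound fC2 x.
apply: (line_lipschitz (fun t => is_derive_line i x t (C2_diff fC2))) => t.
exact: C2_bound_partial fC2 i _.
Qed.

Lemma C2_partial_bcl i : bounded_coord_lipschitz B B (partial i f).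
Proof.
split=> [x|j x]; first exact: C2_bound_partial fC2 i x.
apply: (line_lipschitz (fun t => is_derive_line j x t (C2_diff_partial fC2 i))) => t.
exact: C2_bound_partial2 fC2 i j _.
Qed.

Lemma C2_expR_range x : expR (- B) <= U x <= expR B.
Proof. by have := C2_bound fC2 x; rewrite !ler_expR ler_norml. Qed.

Lemma C2_nspec : nspec (expR (- B)) LU U p.
Proof.
have B0 := C2_ge0 fC2; have e0 := expR_gt0 B.
have Ue x : 0 <= U x <= expR B by rewrite expR_ge0; case/andP: (C2_expR_range x).
have dU i x (t : R) : is_derive t 1 (fun s => U (setc i x s)) (p i (setc i x t)).
  exact: is_derive1_expR_comp (is_derive_line i x t (C2_diff fC2)).
have pB i x : `|p i x| <= LU.
  rewrite normrM (ger0_norm (expR_ge0 _)); apply: ler_pM => //.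
  - by case/andP: (Ue x).
  - apply: le_trans (C2_bound_partial fC2 i x) _.
    by rewrite addrAC lerDr addr_ge0// sqr_ge0.
have dp i j x (t : R) : is_derive t 1 (fun s => p i (setc j x s))
    (U (setc j x t) * (partial j f (setc j x t) * partial i f (setc j x t) +
      partial j (partial i f) (setc j x t))).
  have := is_derive1M (dU j x t) (is_derive_line j x t (C2_diff_partial fC2 i)).
  by move=> /is_derive_eq; apply; rewrite /p /U; ring.
have pL i j x : forall s t, `|p i (setc j x s) - p i (setc j x t)| <= LU * `|s - t|.
  apply: (line_lipschitz (dp i j x)) => t.
  rewrite normrM (ger0_norm (expR_ge0 _)); apply: ler_pM => //.
    by case/andP: (Ue (setc j x t)).
  apply: le_trans (ler_normD _ _) _.
  apply: le_trans (_ : B ^+ 2 + B <= _); last by lra.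
  apply: lerD; last exact: C2_bound_partial2 fC2 i j _.
  rewrite normrM expr2; apply: ler_pM => //.
    exact: C2_bound_partial fC2 j _.
  exact: C2_bound_partial fC2 i _.
split.
- move=> x; have /andP[h1 h2] := C2_expR_range x; rewrite h1/=.
  apply: le_trans h2 _; rewrite ler_peMr ?(ltW e0)//.
  by rewrite -addrA lerDl addr_ge0// sqr_ge0.
- by move=> i x; apply: (line_lipschitz (dU i x)) => t; exact: pB.
- by move=> i x; apply: line_taylor (dU i x) _ => s t; exact: pL.
- by move=> j; split=> [x|i x s t]; [exact: pB|exact: pL].
Qed.

Lemma Ffun_dist (Q : R) : exists2 C : R, 0 < C & forall y z : R,
  0 <= y <= Q -> 0 <= z <= Q -> `|Ffun y - Ffun z| <= C * `|y - z|.
Proof.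
have [C C0 HC] := @Ffun_lipschitz R Q; exists C => //.
have key y z : 0 <= y -> y <= z -> z <= Q -> `|Ffun z - Ffun y| <= C * `|z - y|.
  move=> y0 yz zQ; have h1 : 0 <= Ffun z - Ffun y by rewrite subr_ge0; exact: Ffun_le.
  have h2 : 0 <= z - y by rewrite subr_ge0.
  by rewrite (ger0_norm h1) (ger0_norm h2) lerBlDl; exact: HC.
move=> y z /andP[y0 yQ] /andP[z0 zQ]; have [yz|/ltW zy] := leP y z; last exact: key.
by rewrite distrC (distrC y); exact: key.
Qed.

Definition gradF x : R := Ffun (enorm (gradient f x)).

Lemma enorm_gradientE x : enorm (gradient f x) = rnorm 0 (fun i => partial i f x).
Proof.
by rewrite /enorm /rnorm add0r; congr Num.sqrt; apply: eq_bigr => i _; rewrite mxE.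
Qed.

Lemma enorm_gradient_le x : enorm (gradient f x) <= n%:R * B.
Proof.
rewrite enorm_gradientE; apply: le_trans (rnorm_le_sum _ (fun=> 0) (lexx 0)) _.
rewrite {1}/rnorm big1 ?addr0 ?sqrtr0 ?add0r; last by move=> i _; rewrite expr0n.
by apply: sumr_le_card => i; rewrite subr0; exact: C2_bound_partial fC2 i x.
Qed.

Lemma enorm_gradient_ge0 x : 0 <= enorm (gradient f x).
Proof. exact: sqrtr_ge0. Qed.

Lemma gradF_bcl : exists2 L : R, 0 <= L & exists B', bounded_coord_lipschitz B' L gradF.
Proof.
have [C C0 HC] := Ffun_dist (n%:R * B).
have B0 := C2_ge0 fC2.
have range y : 0 <= enorm (gradient f y) <= n%:R * B.
  by rewrite enorm_gradient_ge0 enorm_gradient_le.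
exists (C * (n%:R * B)); first by apply: mulr_ge0; [exact: ltW|exact: mulr_ge0].
exists (Ffun (n%:R * B)); split=> [x|i x s t].
  have /andP[h1 h2] := range x.
  rewrite /gradF (ger0_norm (Ffun_ge0 (enorm (gradient f x)))); exact: Ffun_le.
apply: le_trans (HC _ _ (range _) (range _)) _; rewrite -[leRHS]mulrA.
apply: ler_wpM2l; first exact: ltW.
rewrite !enorm_gradientE; apply: le_trans (rnorm_dist _ _ (lexx 0)) _.
rewrite -mulrA; apply: sumr_le_card => j.
exact: (C2_partial_bcl j).2.
Qed.

(** M(e^f, y) = f + F(y / e^f), and for y = sqrt(ep + |grad e^f|^2) the quotient exceeds |grad f| by
    at most sqrt ep / m, where m = e^(-B) <= e^f. F is Lipschitz on the bounded range of these
    arguments. *)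
Lemma C2_Minv : exists2 C : R, 0 < C & forall ep, 0 < ep -> ep <= 1 ->
  Minv ep U p (fun x => f x + gradF x + C * Num.sqrt ep).
Proof.
pose m := expR (- B); have m0 : 0 < m by exact: expR_gt0.
have [C C0 HC] := @Ffun_lipschitz R (n%:R * B + m^-1).
exists (C / m); first by rewrite divr_gt0.
move=> ep ep0 ep1 x; have sep0 : 0 <= Num.sqrt ep by exact: sqrtr_ge0.
have U0 : 0 < U x by exact: expR_gt0.
have Um : m <= U x by case/andP: (C2_expR_range x).
rewrite /Mfun /U expRK -addrA lerD2l.
have sep1 : Num.sqrt ep <= 1 by rewrite -sqrtr1 ler_wsqrtr.
have r0 : 0 <= rnorm ep (p^~ x) / expR (f x) by rewrite divr_ge0 ?rnorm_ge0 ?expR_ge0.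
have r1 : rnorm ep (p^~ x) / expR (f x) <= enorm (gradient f x) + Num.sqrt ep / m.
  rewrite ler_pdivrMr ?expR_gt0// mulrDl.
  have e : enorm (gradient f x) * expR (f x) = rnorm 0 (p^~ x).
    rewrite enorm_gradientE /rnorm /p !add0r.
    under [in RHS]eq_bigr do rewrite exprMn.
    by rewrite -mulr_sumr sqrtrM ?sqr_ge0// sqrtr_sqr gtr0_norm ?expR_gt0// mulrC.
  rewrite e; apply: (@le_trans _ _ (rnorm 0 (p^~ x) + Num.sqrt ep)).
    rewrite /rnorm add0r; set S := \sum_i _.
    have S0 : 0 <= S by rewrite sumr_ge0// => i _; exact: sqr_ge0.
    have h0 : 0 <= Num.sqrt S + Num.sqrt ep by rewrite addr_ge0.
    rewrite -(ger0_norm h0) -sqrtr_sqr ler_wsqrtr// sqrrD !sqr_sqrtr ?(ltW ep0)//.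
    have : 0 <= Num.sqrt S * Num.sqrt ep by rewrite mulr_ge0.
    by rewrite -mulr_natr; lra.
  rewrite lerD2l -mulrA ler_peMr// mulrC ler_pdivlMr// mul1r.
  exact: Um.
apply: le_trans (Ffun_le r0 r1) _.
have q0 : 0 <= Num.sqrt ep / m by rewrite divr_ge0// ltW.
apply: le_trans (HC (enorm (gradient f x)) _ _ _ _) _.
- exact: enorm_gradient_ge0.
- by rewrite lerDl.
- apply: lerD; first exact: enorm_gradient_le.
  by rewrite ler_piMl// invr_ge0 ltW.
- by rewrite /gradF lerD2l addrAC subrr add0r mulrA mulrAC.
Qed.

Lemma ln_avgs_expR_le r x : ln (avgs r U x) <= avgs r (fun y => f y + gradF y) x.
Proof.
have [C C0 HC] := C2_Minv; have [LF LF0 [BF gBL]] := gradF_bcl.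
have B0 := C2_ge0 fC2.
have fgBL := bounded_coord_lipschitzD C2_f_bcl gBL.
have L0 : 0 <= B + LF by rewrite addr_ge0.
have e0 := expR_gt0 (- B).
apply/ler_addgt0Pr => e egt0.
(* For ep = s^2 the error C sqrt ep is C s <= e, and ep <= 1. *)
pose s : R := Num.min 1 (e / C).
have s0 : 0 < s by rewrite lt_min ltr01 divr_gt0.
have s1 : s <= 1 by rewrite ge_min lexx.
have sC : C * s <= e.
  by rewrite mulrC -ler_pdivlMr// ge_min lexx orbT.
have ep0 : 0 < s ^+ 2 by rewrite exprn_gt0.
have ep1 : s ^+ 2 <= 1 by rewrite expr2 mulr_ile1// ltW.
have inv := HC _ ep0 ep1.
rewrite sqrtr_sqr gtr0_norm// in inv.
have mL : expR (- B) <= LU.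
  by have /andP[h1 h2] := nspec_range C2_nspec 0; exact: le_trans h1 h2.
have VBL := bounded_coord_lipschitz_addr (C * s) fgBL.
apply: le_trans (ln_avgs_le r x e0 mL ep0 L0 C2_nspec VBL inv) _.
by rewrite (avgs_cstD r (C * s) x L0 fgBL) lerD2l.
Qed.

End test_functions.

Theorem mainTheorem3 (R : realType) (n : nat) (n_ge1 : (1 <= n)%N)
    (d : measure_display) (T : measurableType d) (P : probability T R)
    (X : T -> 'rV[R]_n) (gaussX : standard_gaussian_vector P X)
    (f : 'rV[R]_n -> R) (f_test : test_function f) :
  (lne 'E_P[fun w => (expR (f (X w) - fine 'E_P[fun w' => f (X w')]))%R]
   <= 'E_P[fun w => Ffun (enorm (gradient f (X w)))])%E.
Proof.
have [B fC2] := test_function_C2_bounded f_test.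
have fBL := C2_f_bcl fC2.
have [LF LF0 [BF gBL]] := gradF_bcl fC2.
have B0 := C2_ge0 fC2; have e0 := expR_gt0 (- B).
have Uspec := C2_nspec fC2.
have UBL := nspec_bounded_coord_lipschitz (ltW e0) Uspec.
have LU0 : 0 <= expR B * (1 + B + B ^+ 2).
  by rewrite mulr_ge0 ?expR_ge0// !addr_ge0// sqr_ge0.
rewrite (expectation_PE gaussX fBL)/=; set c := PE P X f.
have WBL : bounded_coord_lipschitz (expR (- c) * (expR B * (1 + B + B ^+ 2)))
    (expR (- c) * (expR B * (1 + B + B ^+ 2))) (fun x => expR (f x - c)).
  have ec := expR_ge0 (- c).
  split=> [x|i x s t]; first by rewrite expRD mulrC normrM (ger0_norm ec) ler_wpM2l// UBL.1.
  rewrite !expRD -mulrBl mulrC normrM (ger0_norm ec) -mulrA ler_wpM2l//.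
  exact: UBL.2.
rewrite (expectation_PE gaussX WBL) (expectation_PE gaussX gBL).
have PEW : PE P X (fun x => expR (f x - c)) = expR (- c) * PE P X (fun x => expR (f x)).
  rewrite /PE -RintegralZl//; last exact: integrable_bounded_coord_lipschitz UBL.
  by apply: eq_Rintegral => w _; rewrite expRD mulrC.
have UE := PE_avgs_enum gaussX 0 LU0 UBL.
(* Positivity reduces the extended logarithm to the real one. *)
have PU0 : 0 < PE P X (fun x => expR (f x)).
  apply: (lt_le_trans e0).
  have <- : \int[P]_w expR (- B) = expR (- B).
    by rewrite Rintegral_cst// [X in fine X]probability_setT mulr1.
  apply: le_Rintegral => //.
  - exact: finite_measure_integrable_cst.
  - exact: integrable_bounded_coord_lipschitz UBL.
  - by move=> w _; case/andP: (C2_expR_range fC2 (X w)).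
rewrite lne_EFin ?PEW ?mulr_gt0 ?expR_gt0// lee_fin lnM ?posrE ?expR_gt0// expRK.
have L0 : 0 <= B + LF by rewrite addr_ge0.
have fgBL := bounded_coord_lipschitzD fBL gBL.
(* The average over all coordinates is constant, so its value at 0 is the expectation. *)
have := ln_avgs_expR_le fC2 (enum 'I_n) 0.
rewrite -UE -(PE_avgs_enum gaussX 0 L0 fgBL).
have -> : PE P X (fun y => f y + gradF f y) = c + PE P X (gradF f).
  rewrite /PE RintegralD//; first exact: integrable_bounded_coord_lipschitz fBL.
  exact: integrable_bounded_coord_lipschitz gBL.
move: (ln _) => l; lra.
Qed.
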